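(* Let $g:([n]\times\mathbb{Z})^*\to\mathbb{R}$ be a function, let $\alpha>0$, $\delta\in(0,1)$, and let $\mathcal{A}$ be an oblivious streaming algorithm for $g$ that uses space $L(\frac{\alpha}{10},\frac{1}{10})$ and guarantees, for streams of length $m$, that with probability at least $\frac{9}{10}$ all its estimates are accurate to within multiplicative error $(1\pm\frac{\alpha}{10})$. Then there exists an adversarially robust streaming algorithm for $g$ that, for streams of length $m$ chosen by an adaptive adversary, guarantees with probability at least $1-\delta$ that all its estimates are accurate to within multiplicative error $(1\pm\alpha)$, using space $$O\left( L\left(\tfrac{\alpha}{10},\tfrac{1}{10}\right)\cdot\sqrt{\lambda_{\frac{\alpha}{10},m}(g)\cdot\log\left(\tfrac{1}{\delta}\right)}\cdot\log\left(\tfrac{m}{\alpha\delta}\right)\right).$$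
   Context: A stream of length $m$ over $[n]$ is a sequence of updates $(a_1,\Delta_1),\dots,(a_m,\Delta_m)$ with $a_i\in[n]$, $\Delta_i\in\mathbb{Z}$; $\vec a_i=((a_1,\Delta_1),\dots,(a_i,\Delta_i))$ is its prefix of length $i$. After each update $i$ a streaming algorithm must output an estimate $z_i$ of $g(\vec a_i)$; an estimate $z$ is accurate to within multiplicative error $(1\pm\beta)$ if $z\in[(1-\beta)g(\vec a_i),(1+\beta)g(\vec a_i)]$. An oblivious streaming algorithm has its guarantee for any fixed stream chosen independently of its randomness. Adversarial robustness is defined via a game: in round $i$ an adaptive Adversary chooses the update $(a_i,\Delta_i)$ as a function of all previous updates and all previous outputs of the algorithm, and then the algorithm processes it and outputs $z_i$; the adversary wins if some $z_i$ is not accurate. The $(\alpha,m)$-flip number $\lambda_{\alpha,m}(g)$ is the maximum, over all streams of length $m$, of the largest $\ell$ for which there are indices $0\le i_1<\dots<i_\ell\le m$ with $g(\vec a_{i_{j+1}})\notin(1\pm\alpha)\,g(\vec a_{i_j})$ for all $j<\ell$ (i.e. the maximal number of times the value of $g$ can change by a factor $(1+\alpha)$ during a stream of length $m$). Standing assumptions: $\log m=\Theta(\log n)$, and $g$ (and the estimates of $\mathcal{A}$) take values bounded polynomially in $n$, namely in $[-n^c,-1/n^c]\cup\{0\}\cup[1/n^c,n^c]$ for some constant $c>0$.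
   Formalization: In the space bound, log(1/δ) and log(m/(αδ)) are replaced by their maximum with 1 (natural logarithms), since the literal bound tends to 0 as δ tends to 1 and is negative for α > m/δ, where it fails. *)

(* Defs.v *)
From HB Require Import structures.
From mathcomp Require Import all_boot all_order all_algebra.
From mathcomp Require Import all_classical all_reals all_analysis.

Set Implicit Arguments.
Unset Strict Implicit.
Unset Printing Implicit Defensive.

Import Order.TTheory GRing.Theory Num.Theory.
Local Open Scope ring_scope.

Definition update (n : nat) : Type := ('I_n * int)%type.

Definition stream (n : nat) : Type := seq (update n).

Record fdist (R : realType) (T : finType) := FDist {
  pmf :> T -> R;
  pmf_ge0 : forall x, 0 <= pmf x;
  pmf_sum1 : \sum_x pmf x = 1 }.

(* A randomized streaming algorithm is a probabilistic automaton over its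
   memory configurations.  [step s u] is the law of the new configuration when
   [u] is processed in configuration [s]: the coins are fresh at each update,
   so random bits that are used again later (e.g. a hash function) have to be
   kept in memory and count towards the space.  There is no free clock either. *)
Record algorithm (R : realType) (n : nat) := Algorithm {
  state : finType;
  init : fdist R state;
  step : state -> update n -> fdist R state;
  estimate : state -> R }.

(* Space in bits: the least [b] such that [#|state A| <= 2 ^ b]. *)
Definition space_bits (R : realType) (n : nat) (A : algorithm R n) : nat :=
  up_log 2 #|state A|.

(* [z] lies in the interval with endpoints [(1 - beta) * y] and
   [(1 + beta) * y]; the endpoints are exchanged when [y < 0]. *)
Definition accurate (R : realType) (beta y z : R) : bool :=
  Num.min ((1 - beta) * y) ((1 + beta) * y) <= z
    <= Num.max ((1 - beta) * y) ((1 + beta) * y).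

(* Updates and estimates of the rounds already played, oldest first. *)
Definition transcript (R : realType) (n : nat) : Type := seq (update n * R).

Definition adversary (R : realType) (n : nat) : Type :=
  transcript R n -> update n.

(* Probability that, when [k] more rounds are played from the transcript [h]
   and the configuration [s], the final transcript satisfies [E]. *)
Fixpoint game_prob_from (R : realType) (n : nat) (A : algorithm R n)
    (adv : adversary R n) (E : pred (transcript R n))
    (k : nat) (h : transcript R n) (s : state A) : R :=
  if k is k'.+1 then
    \sum_(s' : state A) step s (adv h) s' *
      game_prob_from adv E k' (rcons h (adv h, estimate s')) s'
  else (E h)%:R.

Definition game_prob (R : realType) (n : nat) (A : algorithm R n)
    (adv : adversary R n) (m : nat) (E : pred (transcript R n)) : R :=
  \sum_(s : state A) init A s * game_prob_from adv E m [::] s.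

Definition all_accurate (R : realType) (n : nat) (g : stream n -> R) (beta : R)
    (h : transcript R n) : bool :=
  [forall i : 'I_(size h),
     accurate beta (g (take i.+1 (unzip1 h))) (nth 0 (unzip2 h) i)].

(* A fixed stream of length [m], given by the first [m] terms of [u], is the
   adversary that ignores the estimates. *)
Definition oblivious_guarantee (R : realType) (n : nat) (g : stream n -> R)
    (m : nat) (beta p : R) (A : algorithm R n) : Prop :=
  forall u : nat -> update n,
    p <= game_prob A (fun h => u (size h)) m (all_accurate g beta).

Definition robust_guarantee (R : realType) (n : nat) (g : stream n -> R)
    (m : nat) (beta p : R) (A : algorithm R n) : Prop :=
  forall adv : adversary R n, p <= game_prob A adv m (all_accurate g beta).

(* [idx] is [i_1 < ... < i_l] in [0, m]; [sorted] relates consecutive terms. *)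
Definition has_flips (R : realType) (n : nat) (alpha : R) (m : nat)
    (g : stream n -> R) (l : nat) : Prop :=
  exists (s : m.-tuple (update n)) (idx : seq nat),
    [/\ size idx = l, all (fun i => i <= m)%N idx, sorted ltn idx
      & sorted (fun i j => ~~ accurate alpha (g (take i s)) (g (take j s))) idx].

(* [l] distinct indices in [0, m] force [l <= m.+1]. *)
Definition flip_number (R : realType) (n : nat) (alpha : R) (m : nat)
    (g : stream n -> R) : nat :=
  \max_(l < m.+2 | `[< has_flips alpha m g l >]) l.

Definition poly_range (R : realType) (n : nat) (c x : R) : bool :=
  [|| - (n%:R `^ c) <= x <= - (n%:R `^ c)^-1, x == 0
    | (n%:R `^ c)^-1 <= x <= n%:R `^ c].

(* Logarithm inside an O-bound, cut off below at 1 as usual.  Without the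
   cut-off, bounds such as log(1/delta) and log(m/(alpha * delta)) vanish as
   delta tends to 1, or are negative for large alpha, and the space bound
   fails; it changes nothing when the argument is at least e. *)
Definition Olog (R : realType) (x : R) : R := Num.max 1 (ln x).

(* Main.v *)
Require Import Defs.
From HB Require Import structures.
From mathcomp Require Import all_boot all_order all_algebra.
From mathcomp Require Import all_classical all_reals all_analysis.
From mathcomp Require Import ring lra zify.

(* The robust algorithm runs k copies of the oblivious one and publishes a
   candidate from a finite grid.  After each update a copy votes for a candidate
   close to its own estimate; the published candidate, if it has v votes, is
   replaced with probability 1 / (1 + exp (e0 (v - k / 2))), and its successor is
   drawn with probability proportional to exp (e0 * votes).  At most lambda
   replacements are made, lambda being the flip number.

   If a set T of t copies is ignored (it votes for everything), the
   likelihood of the outputs changes by a factor whose second moment is at most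
   exp (5 (e0 t)^2 lambda): steps without replacement cost nothing, because the
   replacement probability is logistic in v.  When T is ignored the adaptive
   stream is independent of the copies in T, so all of them fail with
   probability at most 10^-t; by Cauchy-Schwarz this remains exponentially small
   in t when T is not ignored, and counting the sets T shows that fewer than 2/5
   of the copies ever fail, except with probability exp (- t / 20).  As long as
   this holds, every replacement is correct and forced by a flip of g up to a
   probability (1 + |grid|) exp (- e0 k / 10) per step.  The choices
   t ~ log (1 / delta), e0 ~ (lambda log (1 / delta))^-1/2 and
   k ~ log (m / (alpha delta)) / e0 give the bound. *)

Set Implicit Arguments.
Unset Strict Implicit.
Unset Printing Implicit Defensive.

Import Order.TTheory GRing.Theory Num.Theory.
Local Open Scope ring_scope.

(** * Chi-square estimates *)

Lemma expR_le_inv (R : realType) (x : R) : x < 1 -> expR x <= (1 - x)^-1.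
Proof.
move=> x1; rewrite -[x in expR x]opprK expRN lef_pV2 ?posrE ?expR_gt0 ?subr_gt0 //.
exact: expR_ge1Dx.
Qed.

(** With [u = expR (- x)] the right side is [1 - (1 - u)^2] and [1 - u <= e], which suffices for
    small [e]; for [e > 1/2] it is at least [expR (- e)], and [e <= 2 e^2]. *)
Lemma expR_sqr_le (R : realType) (e x : R) : 0 <= x <= e ->
  expR (- (2 * e ^+ 2)) <= 2 * expR (- x) - expR (- x) ^+ 2.
Proof.
move=> /andP[x0 xe].
have e0 : 0 <= e by exact: le_trans xe.
apply: (@le_trans _ _ (2 * expR (- e) - expR (- e) ^+ 2)); last first.
  have : expR (- e) <= expR (- x) by rewrite ler_expR lerN2.
  have : expR (- x) <= 1 by rewrite -[leRHS]expR0 ler_expR oppr_le0.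
  nra.
have u1 : expR (- e) <= 1 by rewrite -[leRHS]expR0 ler_expR oppr_le0.
have [e12|e12] := leP e 2^-1.
  have u0 : 1 - e <= expR (- e) by have := expR_ge1Dx (- e); lra.
  apply: (@le_trans _ _ (1 - e ^+ 2)); last by nra.
  rewrite expRN -[leRHS]invrK lef_pV2 ?posrE ?expR_gt0 ?invr_gt0 //; last nra.
  apply: le_trans (expR_ge1Dx _).
  rewrite -[leLHS]mul1r ler_pdivrMr; last nra.
  have : e ^+ 2 <= 2^-1 by nra.
  have : 0 <= e ^+ 2 by nra.
  nra.
apply: (@le_trans _ _ (expR (- e))).
  rewrite ler_expR; nra.
have := expR_ge0 (- e); nra.
Qed.

(** The first-order terms cancel, so the excess over 1 is of order [e^2]; for [e > 1/2] the bound
    [e <= 3 e^2] is enough. *)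
Lemma cosh_le_expR_sqr (R : realType) (e : R) : 0 <= e ->
  expR e + expR (- e) - 1 <= expR (3 * e ^+ 2).
Proof.
move=> e0.
have u1 : expR (- e) <= 1 by rewrite -[leRHS]expR0 ler_expR oppr_le0.
have [e12|e12] := leP e 2^-1.
  apply: le_trans (expR_ge1Dx _).
  have h1 : expR e <= 1 + e + 2 * e ^+ 2.
    apply: (le_trans (expR_le_inv _)); first lra.
    have e1 : 0 < 1 - e by lra.
    rewrite -[leLHS]mul1r ler_pdivrMr //.
    have : 0 <= e ^+ 2 by nra.
    nra.
  have h2 : expR (- e) <= 1 - e + e ^+ 2.
    apply: (le_trans (expR_le_inv _)); first lra.
    rewrite opprK -[leLHS]mul1r ler_pdivrMr; last lra.
    have : 0 <= e ^+ 2 by nra.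
    nra.
  lra.
apply: (@le_trans _ _ (expR e)); first lra.
rewrite ler_expR; nra.
Qed.

(** Each ratio [rho = s / s'] lies between [expR (- e)] and [expR e], so
    [(expR e - rho) (rho - expR (- e)) >= 0] bounds [rho^2] by its chord; averaging over [s'] leaves
    [2 cosh e - 1]. *)
Lemma softmax_chi2 (R : realType) (X : finType) (s s' : X -> R) (e : R) :
  0 <= e -> (forall x, 0 < s x) -> (forall x, 0 < s' x) ->
  \sum_x s x = 1 -> \sum_x s' x = 1 ->
  (forall x, s x <= expR e * s' x) -> (forall x, s' x <= expR e * s x) ->
  \sum_x s x ^+ 2 / s' x <= expR (3 * e ^+ 2).
Proof.
move=> e0 s0 s0' s1 s1' h h'; apply: le_trans (cosh_le_expR_sqr e0).
have -> : expR e + expR (- e) - 1 =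
    \sum_x ((expR e + expR (- e)) * s x - s' x).
  by rewrite sumrB -mulr_sumr s1 s1' mulr1.
apply: ler_sum => x _; rewrite ler_pdivrMr //.
have E : expR e * expR (- e) = 1 by rewrite expRxMexpNx_1.
rewrite -subr_ge0.
have -> : ((expR e + expR (- e)) * s x - s' x) * s' x - s x ^+ 2 =
   (expR e * s' x - s x) * (s x - expR (- e) * s' x) +
   (expR e * expR (- e) - 1) * s' x ^+ 2 by ring.
rewrite E subrr mul0r addr0.
apply: mulr_ge0; first by rewrite subr_ge0.
rewrite subr_ge0 -(ler_pM2l (expR_gt0 e)) mulrA E mul1r; exact: h'.
Qed.

(* With p = 1 / (1 + w) and p' = 1 / (1 + w expR x) this bounds the chi-square
   divergence of two Bernoulli laws when a success is discounted: the failures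
   come for free. *)
Lemma fire_chi2 (R : realType) (w w' e x : R) : 0 < w -> 0 <= x <= e ->
  w' = w * expR x ->
  (w / (1 + w)) ^+ 2 / (w' / (1 + w')) +
    expR (- (2 * e ^+ 2)) * ((1 + w)^-1 ^+ 2 / (1 + w')^-1) <= 1.
Proof.
move=> w0 xe w'E; have := expR_sqr_le xe.
set f := expR (- (2 * e ^+ 2)) => hf.
have f1 : f <= 1.
  rewrite -[leRHS]expR0 ler_expR; have := sqr_ge0 e; lra.
have E : expR x * expR (- x) = 1 by rewrite expRxMexpNx_1.
move: w'E hf E; have := expR_gt0 x; have := expR_gt0 (- x).
move: (expR x) (expR (- x)) => q u u0 q0 -> hf E.
have uE : u = q^-1 by apply: (mulfI (lt0r_neq0 q0)); rewrite E divff ?gt_eqF.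
have wq : 0 < w * q by exact: mulr_gt0.
have -> : (w / (1 + w)) ^+ 2 / (w * q / (1 + w * q)) +
    f * ((1 + w)^-1 ^+ 2 / (1 + w * q)^-1) =
  (1 + w * q) * (w * u + f) / (1 + w) ^+ 2.
  rewrite uE; field.
  rewrite !gt_eqF //; lra.
rewrite ler_pdivrMr ?exprn_gt0 ?mul1r //; last lra.
have -> : (1 + w * q) * (w * u + f) = w * u + f + w ^+ 2 * (q * u) + w * (q * f).
  ring.
rewrite E mulr1.
have : q * f <= 2 - u.
  have -> : 2 - u = q * (2 * u - u ^+ 2).
    transitivity (2 * (q * u) - (q * u) * u); first by rewrite E mulr1 mul1r.
    ring.
  by rewrite ler_pM2l.
nra.
Qed.

(** * The robust algorithm *)

Lemma sum_option (V : nmodType) (X : finType) (F : option X -> V) :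
  \sum_o F o = F None + \sum_x F (Some x).
Proof.
rewrite (bigD1 None) //=; congr (_ + _).
by rewrite (reindex_omap Some id) //= => [|[]//]; apply: eq_bigl => x; rewrite eqxx.
Qed.

Lemma sum_delta (R : pzSemiRingType) (X : finType) (c : X) (F : X -> R) :
  \sum_x (x == c)%:R * F x = F c.
Proof.
rewrite (bigD1 c) //= eqxx mul1r big1 ?addr0 // => x /negbTE->.
by rewrite mul0r.
Qed.

Lemma sum_ffun_pair (V : nmodType) (I X Y : finType)
    (F : {ffun I -> X * Y} -> V) :
  \sum_f F f =
  \sum_(p : {ffun I -> X} * {ffun I -> Y}) F [ffun i => (p.1 i, p.2 i)].
Proof.
apply: reindex; apply: onW_bij.
exists (fun f : {ffun I -> X * Y} => ([ffun i => (f i).1], [ffun i => (f i).2])).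
  by move=> [f1 f2]; congr (_, _); apply/ffunP => i; rewrite !ffunE.
by move=> f; apply/ffunP => i; rewrite !ffunE -surjective_pairing.
Qed.

Lemma sum_prod_eq1 (R : comPzSemiRingType) (I X : finType) (P : I -> X -> R) :
  (forall i, \sum_x P i x = 1) -> \sum_(f : {ffun I -> X}) \prod_i P i (f i) = 1.
Proof. by move=> P1; rewrite -bigA_distr_bigA big1. Qed.

Lemma prodr_bool_eq (R : comPzSemiRingType) (I : finType) (P : pred I) :
  \prod_i (P i)%:R = [forall i, P i]%:R :> R.
Proof.
case: forallP => [Pi|]; first by rewrite big1 // => i _; rewrite Pi.
move=> /forallP; rewrite negb_forall => /existsP[i /negbTE Pi].
by rewrite (bigD1 i) //= Pi mul0r.
Qed.

Section RobustAlgorithm.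

Variables (R : realType) (n : nat) (A : algorithm R n).
Variables (a e0 : R) (k Lam : nat) (X : finType) (val : X -> R) (z0 : X).
Local Notation mstate := (X * 'I_Lam.+1)%type.
Implicit Types (T : {set 'I_k}) (x : 'I_k -> state A) (q : mstate).

(* Copies in [T] vote for every candidate, so their content has no influence. *)
Definition votes (tau : R) T x (z : X) : nat :=
  #|[set j | (j \in T) ||
      (`|val z - estimate (x j)| <= tau * `|estimate (x j)|)]|.

(* Tolerances: a candidate chosen within [3 a] of an accurate estimate is within
   [43/10 a] of [g], hence within [8 a] of all accurate estimates until [g]
   flips; and a candidate within [8 a] of one accurate estimate is within
   [10 a] of [g]. *)
Definition keep_odds T x z : R :=
  expR (e0 * ((votes (8 * a) T x z)%:R - k%:R / 2)).

Definition score T x z : R := expR (e0 * (votes (3 * a) T x z)%:R).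

(** The exponential mechanism of differential privacy. *)
Definition choice_prob T x z : R := score T x z / \sum_z' score T x z'.

(* [None] keeps the current candidate, [Some z] replaces it by [z]; at most
   [Lam] replacements are made, and only these have a privacy cost. *)
Definition mech_prob T x q (o : option X) : R :=
  if (q.2 < Lam)%N then
    if o is Some z then (1 + keep_odds T x q.1)^-1 * choice_prob T x z
    else keep_odds T x q.1 / (1 + keep_odds T x q.1)
  else (o == None)%:R.

(** At [q.2 = Lam] the [inord] would fall back to 0, but [mech_prob] gives a replacement probability
    0 there. *)
Definition next q (o : option X) : mstate :=
  if o is Some z then (z, inord q.2.+1) else q.

Lemma score_gt0 T x z : 0 < score T x z. Proof. exact: expR_gt0. Qed.

Lemma sum_score_gt0 T x : 0 < \sum_z score T x z.
Proof.
rewrite (bigD1 z0) //= ltr_pwDl ?score_gt0 // sumr_ge0 // => z _.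
exact: expR_ge0.
Qed.

Lemma choice_prob_gt0 T x z : 0 < choice_prob T x z.
Proof. by rewrite divr_gt0 ?score_gt0 ?sum_score_gt0. Qed.

Lemma sum_choice_prob T x : \sum_z choice_prob T x z = 1.
Proof. by rewrite -mulr_suml divff // gt_eqF // sum_score_gt0. Qed.

Lemma keep_odds_gt0 T x z : 0 < keep_odds T x z. Proof. exact: expR_gt0. Qed.

Lemma keep_odds1_gt0 T x z : 0 < 1 + keep_odds T x z.
Proof. by rewrite addr_gt0 ?keep_odds_gt0. Qed.

Lemma mech_ge0 T x q o : 0 <= mech_prob T x q o.
Proof.
rewrite /mech_prob; case: ifP => // _; case: o => [z|].
  by rewrite mulr_ge0 ?invr_ge0 ?ltW ?choice_prob_gt0 ?keep_odds1_gt0.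
by rewrite divr_ge0 // ltW ?keep_odds_gt0 ?keep_odds1_gt0.
Qed.

Lemma sum_mech T x q : \sum_o mech_prob T x q o = 1.
Proof.
rewrite sum_option /mech_prob; case: ifP => _; last by rewrite big1 ?addr0.
rewrite -mulr_sumr sum_choice_prob mulr1 -[X in _ + X]mul1r -mulrDl addrC.
by rewrite divff // gt_eqF ?keep_odds1_gt0.
Qed.

Definition robust_state := ({ffun 'I_k -> state A} * mstate)%type.

Definition robust_init_pmf (s : robust_state) : R :=
  (\prod_j init A (s.1 j)) * (s.2 == (z0, ord0))%:R.

Definition robust_step_pmf (s : robust_state) (u : update n) (s' : robust_state) : R :=
  (\prod_j step (s.1 j) u (s'.1 j)) *
  \sum_o mech_prob finset.set0 (s'.1) s.2 o * (s'.2 == next s.2 o)%:R.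

Lemma robust_init_ge0 s : 0 <= robust_init_pmf s.
Proof. by rewrite mulr_ge0 ?prodr_ge0 // => j _; apply: Defs.pmf_ge0. Qed.

Lemma robust_init_sum1 : \sum_s robust_init_pmf s = 1.
Proof.
rewrite -(pair_bigA _ (fun (x : {ffun 'I_k -> state A}) q =>
  (\prod_j init A (x j)) * (q == (z0, ord0))%:R)) /=.
under eq_bigr => x _.
  rewrite -mulr_sumr (eq_bigr (fun q => (q == (z0, ord0))%:R * 1)); last first.
    by move=> q _; rewrite mulr1.
  rewrite sum_delta mulr1; over.
exact: (@sum_prod_eq1 _ _ _ (fun=> init A) (fun=> Defs.pmf_sum1 (init A))).
Qed.

Lemma robust_step_ge0 s u s' : 0 <= robust_step_pmf s u s'.
Proof.
rewrite mulr_ge0 ?prodr_ge0 ?sumr_ge0 // => [j _|c _].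
  exact: Defs.pmf_ge0.
by rewrite mulr_ge0 ?mech_ge0.
Qed.

Lemma robust_step_sum s u (F : robust_state -> R) :
  \sum_s' robust_step_pmf s u s' * F s' =
  \sum_(x' : {ffun 'I_k -> state A}) (\prod_j step (s.1 j) u (x' j)) *
    \sum_o mech_prob finset.set0 x' s.2 o * F (x', next s.2 o).
Proof.
rewrite (eq_bigr (fun p => robust_step_pmf s u (p.1, p.2) * F (p.1, p.2))); last first.
  by move=> [].
rewrite -(pair_bigA _ (fun (x' : {ffun 'I_k -> state A}) q' => robust_step_pmf s u (x', q') * F (x', q'))).
apply: eq_bigr => x' _ /=.
under eq_bigr => q' _ do rewrite /robust_step_pmf -mulrA mulr_suml /=.
rewrite -mulr_sumr exchange_big /=; congr (_ * _); apply: eq_bigr => o _.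
under eq_bigr => q' _ do rewrite -mulrA.
by rewrite -mulr_sumr (sum_delta (next s.2 o) (fun q' => F (x', q'))).
Qed.

Lemma robust_step_sum1 s u : \sum_s' robust_step_pmf s u s' = 1.
Proof.
transitivity (\sum_s' robust_step_pmf s u s' * 1).
  by apply: eq_bigr => s' _; rewrite mulr1.
rewrite (robust_step_sum s u (fun=> 1)).
rewrite (eq_bigr (fun x' : {ffun 'I_k -> state A} =>
    \prod_j step (s.1 j) u (x' j))); last first.
  move=> x' _; rewrite (eq_bigr (mech_prob finset.set0 x' s.2)) ?sum_mech ?mulr1 //.
  by move=> c _; rewrite mulr1.
apply: (@sum_prod_eq1 _ _ _ (fun j => step (s.1 j) u)) => j.
exact: Defs.pmf_sum1.
Qed.

Definition robust_alg : algorithm R n :=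
  @Algorithm R n robust_state
    (FDist robust_init_ge0 robust_init_sum1)
    (fun s u => FDist (robust_step_ge0 s u) (robust_step_sum1 s u))
    (fun s => val s.2.1).

Lemma robust_state_card :
  #|state robust_alg| = (#|state A| ^ k * (#|X| * Lam.+1))%N.
Proof. by rewrite /= !card_prod card_ffun !card_ord. Qed.

Lemma votes_sub tau T x z : (votes tau finset.set0 x z <= votes tau T x z)%N.
Proof.
apply: subset_leq_card; apply/fintype.subsetP => j.
by rewrite !inE /= => ->; rewrite orbT.
Qed.

Lemma votes_add tau T x z : (votes tau T x z <= votes tau finset.set0 x z + #|T|)%N.
Proof.
rewrite addnC; apply: leq_trans (leq_card_setU _ _).
by apply: subset_leq_card; apply/fintype.subsetP => j; rewrite !inE.
Qed.

Lemma votes_eq tau T x x' z :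
  (forall j, j \notin T -> x j = x' j) -> votes tau T x z = votes tau T x' z.
Proof.
move=> xx'; apply: eq_card => j; rewrite !inE.
by case: (boolP (j \in T)) => //= /xx' ->.
Qed.

Lemma mech_eq T x x' q o :
  (forall j, j \notin T -> x j = x' j) -> mech_prob T x q o = mech_prob T x' q o.
Proof.
move=> xx'; rewrite /mech_prob /choice_prob /keep_odds /score (votes_eq _ _ xx').
case: o => // z; rewrite (votes_eq _ _ xx'); congr (if _ then _ * (_ / _) else _).
by apply: eq_bigr => z' _; rewrite (votes_eq _ _ xx').
Qed.

Hypothesis e0_ge0 : 0 <= e0.

Lemma score_le T x z : score T x z <= expR (e0 * #|T|%:R) * score finset.set0 x z.
Proof.
rewrite -expRD ler_expR -mulrDr ler_wpM2l // -natrD ler_nat addnC.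
exact: votes_add.
Qed.

Lemma score_ge T x z : score finset.set0 x z <= score T x z.
Proof. by rewrite ler_expR ler_wpM2l // ler_nat votes_sub. Qed.

(** Ignoring [T] only raises vote counts, so weight and normalizer move in the same direction: the
    quotient changes by at most one factor [expR (e0 * #|T|%:R)] either way, not two. *)
Lemma choice_prob_le T x z :
  choice_prob T x z <= expR (e0 * #|T|%:R) * choice_prob finset.set0 x z.
Proof.
rewrite /choice_prob mulrA ler_pM ?score_le ?(ltW (score_gt0 _ _ _)) //.
  by rewrite invr_ge0 ltW // sum_score_gt0.
rewrite lef_pV2 ?posrE ?sum_score_gt0 //.
by apply: ler_sum => z' _; apply: score_ge.
Qed.

Lemma choice_prob_ge T x z :
  choice_prob finset.set0 x z <= expR (e0 * #|T|%:R) * choice_prob T x z.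
Proof.
rewrite /choice_prob mulrCA ler_pM ?score_ge ?(ltW (score_gt0 _ _ _)) //.
  by rewrite invr_ge0 ltW // sum_score_gt0.
rewrite -[X in _ <= X * _]invrK -invfM lef_pV2 ?posrE ?mulr_gt0 ?invr_gt0 ?expR_gt0 ?sum_score_gt0 //.
rewrite -ler_pdivlMl ?invr_gt0 ?expR_gt0 // invrK mulr_sumr.
by apply: ler_sum => z' _; apply: score_le.
Qed.

(** The constant 5 is 2 from [fire_chi2] plus 3 from [softmax_chi2]. *)
Definition cost T : R := 5 * (e0 * #|T|%:R) ^+ 2.

(** The exponential factor is a potential: [Lam - q.2] replacements are left, each prepaid with
    [cost T]. *)
Lemma mech_chi2 T x q :
  \sum_o mech_prob finset.set0 x q o ^+ 2 / mech_prob T x q o *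
     expR (cost T * (Lam%:R - (next q o).2%:R)) <=
  expR (cost T * (Lam%:R - q.2%:R)).
Proof.
(* With the counter exhausted both laws are the point mass at [None]; the other terms are
   [0 / 0 = 0]. *)
rewrite sum_option /mech_prob; case: ifP => qL /=; last first.
  rewrite big1 ?addr0; last by move=> z _; rewrite expr0n /= !mul0r.
  by rewrite expr1n invr1 !mul1r.
set w := keep_odds finset.set0 x q.1; set w' := keep_odds T x q.1.
set e := e0 * #|T|%:R.
have e_ge0 : 0 <= e by rewrite mulr_ge0.
have nextE : (inord q.2.+1 : 'I_Lam.+1) = q.2.+1 :> nat by rewrite inordK.
under eq_bigr => z _.
  rewrite nextE.
  (* One replacement releases [5 e^2]: the part [2 e^2] pays for the decision to replace, [3 e^2]
     for the choice. *)
  have -> : cost T * (Lam%:R - q.2.+1%:R) =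
      - (2 * e ^+ 2) + (- (3 * e ^+ 2) + cost T * (Lam%:R - q.2%:R)).
    by rewrite /cost -/e -natr1; ring.
  rewrite !expRD.
  rewrite (_ : _ * _ = expR (- (2 * e ^+ 2)) * ((1 + w)^-1 ^+ 2 / (1 + w')^-1) *
     (expR (- (3 * e ^+ 2)) * expR (cost T * (Lam%:R - q.2%:R))) *
     (choice_prob finset.set0 x z ^+ 2 / choice_prob T x z)); last first.
    by rewrite invfM exprMn; ring.
  over.
rewrite -mulr_sumr.
have chi : \sum_z choice_prob finset.set0 x z ^+ 2 / choice_prob T x z <= expR (3 * e ^+ 2).
  apply: softmax_chi2 => //; try exact: choice_prob_gt0; try exact: sum_choice_prob.
    exact: choice_prob_ge.
  exact: choice_prob_le.
have fire := @fire_chi2 R w w' e (e0 * ((votes (8 * a) T x q.1)%:R -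
  (votes (8 * a) finset.set0 x q.1)%:R)) (keep_odds_gt0 _ _ _).
set G := expR (cost T * _).
apply: (@le_trans _ _ (((w / (1 + w)) ^+ 2 / (w' / (1 + w')) +
    expR (- (2 * e ^+ 2)) * ((1 + w)^-1 ^+ 2 / (1 + w')^-1)) * G)); last first.
  rewrite -[leRHS]mul1r ler_wpM2r ?expR_ge0 //; apply: fire.
    rewrite mulr_ge0 ?subr_ge0 ?ler_nat ?votes_sub //= ler_wpM2l //.
    by rewrite lerBlDl -natrD ler_nat votes_add.
  by rewrite /w' /w /keep_odds -expRD; congr expR; ring.
rewrite [leRHS]mulrDl lerD2l -!mulrA ler_wpM2l ?expR_ge0 //.
rewrite ler_wpM2l ?exprn_ge0 ?invr_ge0 ?(ltW (keep_odds1_gt0 _ _ _)) // invrK.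
do 2![rewrite ler_wpM2l ?invr_ge0 ?(ltW (keep_odds1_gt0 _ _ _)) //]; rewrite mulrCA ler_piMr ?expR_ge0 //.
rewrite -(ler_pM2l (expR_gt0 (3 * e ^+ 2))) mulrA expRxMexpNx_1 mul1r mulr1.
exact: chi.
Qed.

End RobustAlgorithm.

(** * The game with flagged copies *)

Lemma all_accurateP (R : realType) (n : nat) (g : stream n -> R) (b : R)
    (h : transcript R n) :
  reflect (forall i, (i < size h)%N ->
             accurate b (g (take i.+1 (unzip1 h))) (nth 0 (unzip2 h) i))
          (all_accurate g b h).
Proof.
apply: (iffP forallP) => [H i ih|H i]; first exact: (H (Ordinal ih)).
exact: H.
Qed.

Lemma all_accurate_rcons (R : realType) (n : nat) (g : stream n -> R) (b : R)
    (h : transcript R n) (u : update n) (z : R) :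
  all_accurate g b (rcons h (u, z)) =
  all_accurate g b h && accurate b (g (rcons (unzip1 h) u)) z.
Proof.
have s1 : size (unzip1 h) = size h by rewrite size_map.
have s2 : size (unzip2 h) = size h by rewrite size_map.
apply/all_accurateP/andP => [H|[/all_accurateP H Hz] i].
  split.
    apply/all_accurateP => i ih; have := H i.
    rewrite size_rcons ltnS (ltnW ih) /unzip1 /unzip2 !map_rcons nth_rcons.
    by rewrite size_map ih -cats1 takel_cat ?s1 //; apply.
  have := H (size h); rewrite size_rcons ltnSn /unzip1 /unzip2 !map_rcons.
  rewrite nth_rcons size_map ltnn eqxx take_oversize; first by apply.
  by rewrite size_rcons size_map.
rewrite size_rcons ltnS leq_eqVlt => /orP[/eqP->|ih].
  rewrite /unzip1 /unzip2 !map_rcons nth_rcons size_map ltnn eqxx.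
  by rewrite take_oversize // size_rcons size_map.
rewrite /unzip1 /unzip2 !map_rcons nth_rcons size_map ih.
by rewrite -cats1 takel_cat ?size_map //; apply: H.
Qed.

Section FlaggedGame.

Variables (R : realType) (n : nat) (A : algorithm R n) (g : stream n -> R).
Variables (a e0 : R) (k Lam : nat) (X : finType) (val : X -> R) (z0 : X).
Variable adv : adversary R n.
Local Notation mstate := (X * 'I_Lam.+1)%type.
(* The flag of a copy records whether one of its estimates was inaccurate. *)
Local Notation copy := (bool * state A)%type.
Local Notation copies := {ffun 'I_k -> copy}.
Local Notation noT := (finset.set0 : {set 'I_k}).
Local Notation mech := (mech_prob a e0 val).
Implicit Types (T : {set 'I_k}) (h : transcript R n) (y : copies) (q : mstate).

Definition new_flag (st : stream n) (b : bool) (s : state A) : bool :=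
  b || ~~ accurate a (g st) (estimate s).

Definition kern (st : stream n) (u : update n) (c c' : copy) : R :=
  step c.2 u c'.2 * (c'.1 == new_flag (rcons st u) c.1 c'.2)%:R.

Lemma kern_ge0 st u c c' : 0 <= kern st u c c'.
Proof. by rewrite mulr_ge0 ?Defs.pmf_ge0. Qed.

Lemma sum_kern st u c (F : copy -> R) :
  \sum_c' kern st u c c' * F c' =
  \sum_s step c.2 u s * F (new_flag (rcons st u) c.1 s, s).
Proof.
rewrite (eq_bigr (fun c' => kern st u c (c'.1, c'.2) * F (c'.1, c'.2))); last first.
  by move=> [].
rewrite -(pair_bigA _ (fun b s => kern st u c (b, s) * F (b, s))) exchange_big /=.
apply: eq_bigr => s _; under eq_bigr => b _ do rewrite /kern -mulrA /=.
by rewrite -mulr_sumr (sum_delta _ (fun b => F (b, s))).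
Qed.

Lemma sum_kern1 st u c : \sum_c' kern st u c c' = 1.
Proof.
transitivity (\sum_c' kern st u c c' * 1); first by apply: eq_bigr => ? _; rewrite mulr1.
rewrite (sum_kern st u c (fun=> 1)) -[RHS](Defs.pmf_sum1 (step c.2 u)).
by apply: eq_bigr => ? _; rewrite mulr1.
Qed.

(* The copies in [T] keep running but are ignored by the mechanism. *)
Fixpoint gvalue T (F : transcript R n -> copies -> R) m h y q : R :=
  if m is m'.+1 then
    \sum_(y' : copies) (\prod_j kern (unzip1 h) (adv h) (y j) (y' j)) *
      \sum_o mech T (fun j => (y' j).2) q o *
        gvalue T F m' (rcons h (adv h, val (next q o).1)) y' (next q o)
  else F h y.

Lemma prod_kern_ge0 st u y y' : 0 <= \prod_j kern st u (y j) (y' j).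
Proof. by apply: prodr_ge0 => j _; apply: kern_ge0. Qed.

Lemma sum_prod_kern st u y : \sum_(y' : copies) \prod_j kern st u (y j) (y' j) = 1.
Proof. by apply: (@sum_prod_eq1 _ _ _ (fun j => kern st u (y j))) => j; apply: sum_kern1. Qed.

(** With the three lemmas that follow: as a functional of [F], [gvalue] is an expectation. *)
Lemma gvalue_le T F G m h y q : (forall h y, F h y <= G h y) ->
  gvalue T F m h y q <= gvalue T G m h y q.
Proof.
move=> FG; elim: m h y q => [|m IH] h y q //=.
apply: ler_sum => y' _; rewrite ler_wpM2l ?prod_kern_ge0 //.
by apply: ler_sum => o _; rewrite ler_wpM2l // mech_ge0.
Qed.

Lemma gvalue_cst T c m h y q : gvalue T (fun _ _ => c) m h y q = c.
Proof.
elim: m h y q => [|m IH] h y q //=.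
rewrite (eq_bigr (fun y' : copies => (\prod_j kern (unzip1 h) (adv h) (y j) (y' j)) * c)).
  by rewrite -mulr_suml sum_prod_kern mul1r.
move=> y' _; congr (_ * _); under eq_bigr => o _ do rewrite IH.
by rewrite -mulr_suml sum_mech // mul1r.
Qed.

Lemma gvalue_sum T (I : finType) (P : pred I) F m h y q :
  gvalue T (fun h y => \sum_(i | P i) F i h y) m h y q =
  \sum_(i | P i) gvalue T (F i) m h y q.
Proof.
elim: m h y q => [|m IH] h y q //=.
rewrite exchange_big /=; apply: eq_bigr => y' _.
rewrite -mulr_sumr; congr (_ * _); rewrite exchange_big; apply: eq_bigr => o _ /=.
by rewrite -mulr_sumr IH.
Qed.

Lemma gvalue_scale T (c : R) F m h y q :
  gvalue T (fun h y => c * F h y) m h y q = c * gvalue T F m h y q.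
Proof.
elim: m h y q => [|m IH] h y q //=.
rewrite mulr_sumr; apply: eq_bigr => y' _; rewrite mulrCA; congr (_ * _).
by rewrite mulr_sumr; apply: eq_bigr => o _; rewrite IH mulrCA.
Qed.

(** The flags are determined by the play and never read by the mechanism, so summing them out
    restores the original game. *)
Lemma game_prob_from_gvalue (E : pred (transcript R n)) m h
    (x : {ffun 'I_k -> state A}) y q : (forall j, (y j).2 = x j) ->
  game_prob_from (A := robust_alg A a e0 k Lam val z0) adv E m h (x, q) =
  gvalue noT (fun h _ => (E h)%:R) m h y q.
Proof.
elim: m h x y q => [|m IH] h x y q yx //=.
rewrite (robust_step_sum a e0 val (x, q) (adv h) (fun s' =>
  game_prob_from (A := robust_alg A a e0 k Lam val z0) adv E m
    (rcons h (adv h, val s'.2.1)) s')) /=.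
rewrite sum_ffun_pair.
rewrite -(pair_bigA _ (fun (b : {ffun 'I_k -> bool}) (x' : {ffun 'I_k -> state A}) =>
  let y' := [ffun j => (b j, x' j)] in
   (\prod_j kern (unzip1 h) (adv h) (y j) (y' j)) *
      \sum_o mech noT (fun j => (y' j).2) q o *
        gvalue noT (fun h _ => (E h)%:R) m
          (rcons h (adv h, val (next q o).1)) y' (next q o))) exchange_big /=.
apply: eq_bigr => x' _.
rewrite (eq_bigr (fun b : {ffun 'I_k -> bool} =>
    (\prod_j (b j == new_flag (rcons (unzip1 h) (adv h)) (y j).1 (x' j))%:R) *
    ((\prod_j step (x j) (adv h) (x' j)) *
     \sum_o mech noT x' q o * game_prob_from (A := robust_alg A a e0 k Lam val z0)
       adv E m (rcons h (adv h, val (next q o).1)) (x', next q o)))).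
  rewrite -mulr_suml (@sum_prod_eq1 _ _ _ (fun j b =>
    (b == new_flag (rcons (unzip1 h) (adv h)) (y j).1 (x' j))%:R)) ?mul1r // => j.
  rewrite (eq_bigr (fun b => (b == new_flag (rcons (unzip1 h) (adv h)) (y j).1 (x' j))%:R * 1)).
    by rewrite sum_delta.
  by move=> b _; rewrite mulr1.
move=> b _; rewrite mulrA; congr (_ * _).
  rewrite -big_split /=; apply: eq_bigr => j _.
  by rewrite ffunE /kern /= yx mulrC.
apply: eq_bigr => o _; congr (_ * _).
  by apply: mech_eq => j _; rewrite ffunE.
by rewrite (IH _ x' [ffun j => (b j, x' j)]) // => j; rewrite ffunE.
Qed.

Hypothesis e0_ge0 : 0 <= e0.

(* [M V <= (b M' V + M^2 / (b M')) / 2] by AM-GM, so that a likelihood ratio of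
   bounded second moment costs no more than its square root. *)
Lemma gvalue_chi2 T (F : transcript R n -> copies -> bool) m h y q (b : R) : 0 < b ->
  gvalue noT (fun h y => (F h y)%:R) m h y q <=
  (b * gvalue T (fun h y => (F h y)%:R) m h y q +
   b^-1 * expR (cost e0 T * (Lam%:R - q.2%:R))) / 2.
Proof.
elim: m h y q b => [|m IH] h y q b b0 /=.
  have E1 : 1 <= expR (cost e0 T * (Lam%:R - q.2%:R)).
    rewrite -[leLHS]expR0 ler_expR mulr_ge0 ?mulr_ge0 ?sqr_ge0 //.
    by rewrite subr_ge0 ler_nat -ltnS.
  have b0' : 0 < b^-1 by rewrite invr_gt0.
  have bb : b * b^-1 = 1 by rewrite divff // gt_eqF.
  case: (F h y) => /=; last by rewrite mulr0 add0r divr_ge0 // mulr_ge0 ?expR_ge0 ?ltW.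
  rewrite mulr1 ler_pdivlMr // mul1r.
  apply: (@le_trans _ _ (b + b^-1)); last by rewrite lerD2l ler_peMr // ltW.
  have : 0 <= b^-1 * (b - 1) ^+ 2 by rewrite mulr_ge0 ?sqr_ge0 // ltW.
  have -> : b^-1 * (b - 1) ^+ 2 = (b * b^-1) * b - 2 * (b * b^-1) + b^-1 by ring.
  rewrite bb; lra.
set G := expR _.
pose Z T' (y' : copies) := \sum_o mech T' (fun j => (y' j).2) q o *
        gvalue T' (fun h y => (F h y)%:R) m
          (rcons h (adv h, val (next q o).1)) y' (next q o).
(* Both games move the copies by the same kernel, so it is enough to compare the mechanisms for
   fixed new copies [y']. *)
suff step y' : Z noT y' <= (b * Z T y' + b^-1 * G) / 2.
  apply: (@le_trans _ _ (\sum_(y' : copies) (\prod_j kern (unzip1 h) (adv h) (y j) (y' j)) *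
      ((b * Z T y' + b^-1 * G) / 2))).
    by apply: ler_sum => y' _; rewrite ler_wpM2l ?prod_kern_ge0 ?step.
  rewrite le_eqVlt; apply/orP; left; apply/eqP.
  rewrite [in RHS](_ : b^-1 * G =
    \sum_(y' : copies) (\prod_j kern (unzip1 h) (adv h) (y j) (y' j)) * (b^-1 * G)); last first.
    by rewrite -mulr_suml sum_prod_kern mul1r.
  rewrite mulr_sumr -big_split /= mulr_suml; apply: eq_bigr => y' _.
  by rewrite /Z; ring.
have [b0' bN0] : 0 < b^-1 /\ b != 0 by rewrite invr_gt0 gt_eqF.
apply: le_trans (_ : \sum_o (b * (mech T (fun j => (y' j).2) q o *
        gvalue T (fun h y => (F h y)%:R) m
          (rcons h (adv h, val (next q o).1)) y' (next q o)) +
       b^-1 * (mech noT (fun j => (y' j).2) q o ^+ 2 / mech T (fun j => (y' j).2) q o *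
         expR (cost e0 T * (Lam%:R - (next q o).2%:R)))) / 2 <= _); last first.
  rewrite -mulr_suml big_split /= -!mulr_sumr ler_pM2r ?invr_gt0 // lerD2l.
  by rewrite ler_pM2l //; apply: mech_chi2.
apply: ler_sum => o _.
set x := fun j => (y' j).2; set V := gvalue T _ _ _ _ _.
have V0 : 0 <= V.
  rewrite -(gvalue_cst T 0 m (rcons h (adv h, val (next q o).1)) y' (next q o)).
  exact: gvalue_le.
have K0 := mech_ge0 a e0 val z0 noT x q o; have K0' := mech_ge0 a e0 val z0 T x q o.
have [K00|KN0] := eqVneq (mech noT x q o) 0.
  by rewrite K00 mul0r expr0n /= !mul0r mulr0 addr0 divr_ge0 // !mulr_ge0 // ltW.
(* The two mechanisms have the same support, so the likelihood ratio makes sense. *)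
have KN0' : mech T x q o != 0.
  move: KN0; rewrite /mech_prob; case: ifP => // _ _.
  case: o {V V0 K0 K0'} => [z|]; last by rewrite mulf_neq0 ?invr_neq0 // gt_eqF // ?keep_odds_gt0 ?keep_odds1_gt0.
  by rewrite mulf_neq0 ?invr_neq0 // gt_eqF // ?choice_prob_gt0 ?keep_odds1_gt0.
have [K1 K1'] : 0 < mech noT x q o /\ 0 < mech T x q o by rewrite !lt_def KN0 KN0' K0 K0'.
(* The free parameter is rescaled by the likelihood ratio of this outcome; after multiplication by
   [mech noT x q o] the two terms are exactly the required ones. *)
have := IH (rcons h (adv h, val (next q o).1)) y' (next q o) (b * mech T x q o / mech noT x q o).
rewrite -/V !mulr_gt0 ?invr_gt0 // => /(_ isT) /(ler_wpM2l K0) /le_trans; apply.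
rewrite le_eqVlt; apply/orP; left; apply/eqP; field.
by rewrite KN0 KN0' bN0.
Qed.

End FlaggedGame.

(** * Independence of the ignored copies *)

(** Resampling: once all coordinates are drawn, those in [T] may be drawn afresh without changing
    the law. *)
Lemma sum_prod_condition (R : comPzSemiRingType) (I Y : finType) (T : {set I})
    (P : I -> Y -> R) (F : {ffun I -> Y} -> R) :
  (forall i, \sum_c P i c = 1) ->
  \sum_(y : {ffun I -> Y}) (\prod_i P i (y i)) * F y =
  \sum_(r : {ffun I -> Y}) (\prod_i P i (r i)) *
    \sum_(y : {ffun I -> Y}) (\prod_i (if i \in T then P i (y i) else (y i == r i)%:R)) * F y.
Proof.
move=> P1; under [RHS]eq_bigr => r _ do rewrite mulr_sumr.
rewrite exchange_big /=; apply: eq_bigr => y _.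
rewrite (eq_bigr (fun r : {ffun I -> Y} => (\prod_i (P i (r i) *
    (if i \in T then P i (y i) else (y i == r i)%:R))) * F y)); last first.
  by move=> r _; rewrite mulrA -big_split.
rewrite /= -mulr_suml -(bigA_distr_bigA (fun i c =>
   P i c * (if i \in T then P i (y i) else (y i == c)%:R))).
congr (_ * _); apply: eq_bigr => i _; case: (i \in T).
  by rewrite -mulr_suml P1 mul1r.
rewrite -[LHS](sum_delta (y i) (P i)).
by apply: eq_bigr => c _; rewrite mulrC eq_sym.
Qed.

Section Independence.

Variables (R : realType) (n : nat) (A : algorithm R n) (g : stream n -> R).
Variables (a e0 : R) (k Lam : nat) (X : finType) (val : X -> R) (z0 : X).
Variable adv : adversary R n.
Local Notation mstate := (X * 'I_Lam.+1)%type.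
Local Notation copy := (bool * state A)%type.
Local Notation copies := {ffun 'I_k -> copy}.
Local Notation mech := (mech_prob a e0 val).
Local Notation kern := (@kern R n A g a).
Local Notation gvalue := (gvalue (A := A) g a e0 val adv).
Implicit Types (h : transcript R n) (q : mstate).

(** [st] has been processed already, [w] is still to come. *)
Fixpoint flag_prob (w st : stream n) (c : copy) : R :=
  if w is u :: w' then \sum_c' kern st u c c' * flag_prob w' (rcons st u) c'
  else c.1%:R.

Definition all_flagged (T : {set 'I_k}) h (y : copies) : bool :=
  [forall j, (j \in T) ==> (y j).1].

(* The adaptive stream is independent of the ignored copies, so each of them
   sees what could have been a fixed stream. *)
Lemma gvalue_all_flagged (T : {set 'I_k}) (p : R) m h (nu : copy -> R) (r : copies) q :
  (forall c, 0 <= nu c) -> \sum_c nu c = 1 ->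
  (forall w, size w = m -> \sum_c nu c * flag_prob w (unzip1 h) c <= p) ->
  \sum_(y : copies) (\prod_j (if j \in T then nu (y j) else (y j == r j)%:R)) *
     gvalue T (fun h y => (all_flagged T h y)%:R) m h y q <= p ^+ #|T|.
Proof.
elim: m h nu r q => [|m IH] h nu r q nu0 nu1 nup /=.
  (* At the end the copies in [T] are independent with law [nu], so their failure probabilities
     multiply. *)
  rewrite (eq_bigr (fun y : copies => \prod_j (if j \in T then nu (y j) * (y j).1%:R
       else (y j == r j)%:R))); last first.
    move=> y _; rewrite /all_flagged -prodr_bool_eq -big_split /=.
    by apply: eq_bigr => j _; case: ifP; rewrite ?mulr1.
  rewrite -(bigA_distr_bigA (fun j c => if j \in T then nu c * c.1%:R
       else (c == r j)%:R)) (bigID (mem T)) /= [X in _ * X]big1 ?mulr1; last first.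
    move=> j /negbTE ->; rewrite -[RHS](sum_delta (r j) (fun=> 1)).
    by apply: eq_bigr => c _; rewrite mulr1.
  rewrite -prodr_const; apply: ler_prod => j jT; rewrite jT.
  by rewrite sumr_ge0 /= ?(nup [::]) // => c _; rewrite mulr_ge0.
set st := unzip1 h; set u := adv h.
pose D j c : R := if j \in T then nu c else (c == r j)%:R.
have D1 j : \sum_c D j c = 1.
  rewrite /D; case: (j \in T) => //; rewrite -[RHS](sum_delta (r j) (fun=> 1)).
  by apply: eq_bigr => c _; rewrite mulr1.
have D0 j c : 0 <= D j c by rewrite /D; case: ifP.
pose mu j c' := \sum_c D j c * kern st u c c'.
have mu1 j : \sum_c' mu j c' = 1.
  rewrite /mu exchange_big /= -[RHS](D1 j); apply: eq_bigr => c _.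
  by rewrite -mulr_sumr sum_kern1 mulr1.
have mu0 j c' : 0 <= mu j c' by rewrite sumr_ge0 // => c _; rewrite mulr_ge0 // kern_ge0.
pose V (y' : copies) o := gvalue T (fun h y => (all_flagged T h y)%:R) m
   (rcons h (u, val (next q o).1)) y' (next q o).
pose Z (y' : copies) := \sum_o mech T (fun j => (y' j).2) q o * V y' o.
rewrite -/(Z _) (eq_bigr (fun y : copies => \sum_(y' : copies)
   (\prod_j (D j (y j) * kern st u (y j) (y' j))) * Z y')); last first.
  move=> y _; rewrite mulr_sumr; apply: eq_bigr => y' _.
  by rewrite mulrA -big_split.
rewrite exchange_big /= (eq_bigr (fun y' : copies => (\prod_j mu j (y' j)) * Z y')); last first.
  move=> y' _; rewrite -mulr_suml -(bigA_distr_bigA (fun j c => D j c * kern st u c (y' j))).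
  by [].
(* Conditioning on the new configurations outside [T], given by [r'], restores the form of the
   induction hypothesis: the copies in [T] are still independent, now with law [nu']. *)
rewrite (sum_prod_condition T _ mu1).
rewrite [leRHS](_ : _ = \sum_(r' : copies) (\prod_j mu j (r' j)) * p ^+ #|T|); last first.
  by rewrite -mulr_suml sum_prod_eq1 ?mul1r.
apply: ler_sum => r' _.
rewrite ler_wpM2l ?prodr_ge0 //.
pose nu' c' := \sum_c nu c * kern st u c c'.
pose W (y : copies) := \prod_j (if j \in T then nu' (y j) else (y j == r' j)%:R).
(* Where [W y] is nonzero, [y] agrees with [r'] outside [T], so the outcome of the mechanism carries
   no information on the copies in [T]. *)
rewrite (eq_bigr (fun y => \sum_o mech T (fun j => (r' j).2) q o * (W y * V y o))); last first.
  move=> y _.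
  have -> : \prod_i (if i \in T then mu i (y i) else (y i == r' i)%:R) = W y.
    apply: eq_bigr => j _; case: ifP => // jT.
    by apply: eq_bigr => c _; rewrite /D jT.
  have [yr|] := boolP [forall j, (j \notin T) ==> (y j == r' j)].
    rewrite mulr_sumr; apply: eq_bigr => o _; rewrite mulrCA; congr (_ * _).
    apply: mech_eq => j jT.
    by move/forallP: yr => /(_ j); rewrite jT /= => /eqP->.
  rewrite negb_forall => /existsP[j]; rewrite negb_imply => /andP[jT /negbTE yj].
  have -> : W y = 0 by rewrite /W (bigD1 j) //= (negbTE jT) yj mul0r.
  by rewrite mul0r big1 // => o _; rewrite mul0r mulr0.
rewrite exchange_big /=.
under eq_bigr => o _ do rewrite -mulr_sumr.
rewrite [leRHS](_ : _ = \sum_o mech T (fun j => (r' j).2) q o * p ^+ #|T|); last first.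
  by rewrite -mulr_suml sum_mech ?mul1r.
apply: ler_sum => o _; rewrite ler_wpM2l ?mech_ge0 //.
apply: IH => [c||w wm].
- by rewrite sumr_ge0 // => c' _; rewrite mulr_ge0 // kern_ge0.
- rewrite exchange_big /= -[RHS]nu1; apply: eq_bigr => c _.
  by rewrite -mulr_sumr sum_kern1 mulr1.
(* Given [h], the update [u] is fixed, and putting it before [w] gives a fixed stream of length
   [m.+1]. *)
have := nup (u :: w) (congr1 S wm); apply: le_trans.
rewrite /unzip1 map_rcons /= -/(unzip1 h) -/st.
rewrite (eq_bigr (fun c' => \sum_c nu c * (kern st u c c' * flag_prob w (rcons st u) c'))).
  by rewrite exchange_big /=; apply: ler_sum => c _; rewrite mulr_sumr.
by move=> c' _; rewrite mulr_suml; apply: eq_bigr => c _; rewrite mulrA.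
Qed.

End Independence.

(** * Few copies fail *)

(** The quotient of the binomials is the product of [(k - i) / (r - i)] over [i < t]. *)
Lemma bin_ratio (R : realFieldType) (k r t : nat) (rho : R) : 0 <= rho ->
  (forall i, (i < t)%N -> (k - i)%:R <= rho * (r - i)%:R) ->
  'C(k, t)%:R <= rho ^+ t * 'C(r, t)%:R.
Proof.
move=> rho0 H.
have f0 : 0 < (t`!)%:R :> R by rewrite ltr0n fact_gt0.
rewrite -(ler_pM2r f0) -mulrA -!natrM !bin_ffact !ffact_prod !natr_prod.
rewrite -[X in rho ^+ X](card_ord t) -prodr_const -big_split /=.
by apply: ler_prod => i _; rewrite ler0n /=; apply: H.
Qed.

Section ManyFlags.

Variables (R : realType) (n : nat) (A : algorithm R n) (g : stream n -> R).
Variables (a e0 : R) (k Lam : nat) (X : finType) (val : X -> R) (z0 : X).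
Variable adv : adversary R n.
Local Notation copy := (bool * state A)%type.
Local Notation copies := {ffun 'I_k -> copy}.
Local Notation noT := (finset.set0 : {set 'I_k}).
Local Notation gvalue := (gvalue (A := A) g a e0 val adv).
Local Notation flag_prob := (@flag_prob R n A g a).
Implicit Types (T : {set 'I_k}).

Definition init_copy (c : copy) : R := init A c.2 * (c.1 == false)%:R.

Lemma init_copy_ge0 c : 0 <= init_copy c.
Proof. by rewrite mulr_ge0 ?Defs.pmf_ge0. Qed.

Lemma sum_init_copy (F : copy -> R) :
  \sum_c init_copy c * F c = \sum_s init A s * F (false, s).
Proof.
rewrite (eq_bigr (fun c => init_copy (c.1, c.2) * F (c.1, c.2))); last by move=> [].
rewrite -(pair_bigA _ (fun b s => init_copy (b, s) * F (b, s))) exchange_big /=.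
apply: eq_bigr => s _; under eq_bigr => b _ do rewrite /init_copy -mulrA /=.
by rewrite -mulr_sumr (sum_delta _ (fun b => F (b, s))).
Qed.

Lemma sum_init_copy1 : \sum_c init_copy c = 1.
Proof.
transitivity (\sum_c init_copy c * 1); first by apply: eq_bigr => ? _; rewrite mulr1.
rewrite (sum_init_copy (fun=> 1)) -[RHS](Defs.pmf_sum1 (init A)).
by apply: eq_bigr => ? _; rewrite mulr1.
Qed.

Lemma sum_init_copies (F : copies -> R) :
  \sum_(y : copies) (\prod_j init_copy (y j)) * F y =
  \sum_(x : {ffun 'I_k -> state A}) (\prod_j init A (x j)) * F [ffun j => (false, x j)].
Proof.
rewrite sum_ffun_pair.
rewrite -(pair_bigA _ (fun (b : {ffun 'I_k -> bool}) (x : {ffun 'I_k -> state A}) =>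
  let y := [ffun j => (b j, x j)] in (\prod_j init_copy (y j)) * F y)) exchange_big /=.
apply: eq_bigr => x _.
rewrite (eq_bigr (fun b : {ffun 'I_k -> bool} => (b == [ffun=> false])%:R *
    ((\prod_j init A (x j)) * F [ffun j => (b j, x j)]))).
  rewrite sum_delta; congr (_ * F _); apply/ffunP => j; by rewrite !ffunE.
move=> b _; rewrite mulrA; congr (_ * _); rewrite mulrC.
under eq_bigr => j _ do rewrite ffunE /init_copy /=.
rewrite big_split /= prodr_bool_eq; congr (_ * (nat_of_bool _)%:R).
apply/forallP/eqP => [bj|-> j]; last by rewrite ffunE.
by apply/ffunP => j; rewrite ffunE; apply/eqP.
Qed.

Definition gstart T (F : transcript R n -> copies -> R) m : R :=
  \sum_(y : copies) (\prod_j init_copy (y j)) * gvalue T F m [::] y (z0, ord0 : 'I_Lam.+1).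

Lemma prod_init_copy_ge0 (y : copies) : 0 <= \prod_j init_copy (y j).
Proof. by apply: prodr_ge0 => j _; apply: init_copy_ge0. Qed.

Lemma sum_prod_init_copy : \sum_(y : copies) \prod_j init_copy (y j) = 1.
Proof. exact: (@sum_prod_eq1 _ _ _ (fun=> init_copy) (fun=> sum_init_copy1)). Qed.

Lemma game_prob_gstart (E : pred (transcript R n)) m :
  game_prob (robust_alg A a e0 k Lam val z0) adv m E = gstart noT (fun h _ => (E h)%:R) m.
Proof.
rewrite /gstart sum_init_copies /game_prob /=.
rewrite (eq_bigr (fun s => robust_init_pmf z0 (s.1, s.2) *
   game_prob_from (A := robust_alg A a e0 k Lam val z0) adv E m [::] (s.1, s.2))); last by move=> [].
rewrite -(pair_bigA _ (fun (x : {ffun 'I_k -> state A}) q => robust_init_pmf z0 (x, q) *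
   game_prob_from (A := robust_alg A a e0 k Lam val z0) adv E m [::] (x, q))) /=.
apply: eq_bigr => x _.
under eq_bigr => q _ do rewrite /robust_init_pmf -mulrA /=.
rewrite -mulr_sumr (sum_delta (z0, ord0) (fun q => 
   game_prob_from (A := robust_alg A a e0 k Lam val z0) adv E m [::] (x, q))).
congr (_ * _); apply: game_prob_from_gvalue => j; by rewrite ffunE.
Qed.

(** On a fixed stream a copy is flagged exactly when its own transcript is inaccurate; this turns
    the oblivious guarantee into a bound on flags. *)
Lemma flag_prob_game (u : nat -> update n) u0 w h s :
  (forall i, (i < size w)%N -> u (size h + i)%N = nth u0 w i) ->
  game_prob_from (A := A) (fun h => u (size h)) (all_accurate g a) (size w) h s +
    flag_prob w (unzip1 h) (~~ all_accurate g a h, s) = 1.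
Proof.
elim: w h s => [|v w IH] h s uw /=.
  by case: all_accurate; rewrite /= ?addr0 ?add0r.
have uv : u (size h) = v by rewrite -[size h]addn0 (uw 0%N).
rewrite sum_kern -big_split /= -(Defs.pmf_sum1 (step s v)) uv.
apply: eq_bigr => s' _; rewrite -mulrDr -[RHS]mulr1; congr (_ * _).
rewrite -(IH (rcons h (v, estimate s')) s').
  rewrite all_accurate_rcons negb_and /unzip1 map_rcons.
  by [].
by move=> i iw; rewrite size_rcons addSnnS (uw i.+1).
Qed.

Lemma oblivious_flag_prob m p w : oblivious_guarantee g m a p A -> size w = m ->
  (0 < m)%N -> \sum_c init_copy c * flag_prob w [::] c <= 1 - p.
Proof.
move=> obl wm; case: w wm => [<- //|v w] wm _.
(* The guarantee speaks of infinite sequences: the stream is continued by its first update [v]. *)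
rewrite sum_init_copy; have := obl (nth v (v :: w)); rewrite /game_prob -wm => H.
rewrite lerBrDl; apply: le_trans (_ : \sum_s init A s <= _); last by rewrite Defs.pmf_sum1.
move: H; rewrite -(lerD2r (\sum_s init A s * flag_prob (v :: w) [::] (false, s))).
move=> /le_trans; apply; rewrite -big_split /=; apply: ler_sum => s _.
rewrite -mulrDr -[leRHS]mulr1 ler_wpM2l ?Defs.pmf_ge0 //.
have := @flag_prob_game (nth v (v :: w)) v (v :: w) [::] s (fun _ _ => erefl).
have -> : all_accurate g a [::] by apply/all_accurateP.
by move=> /= ->.
Qed.

Lemma gstart_all_flagged T m : oblivious_guarantee g m a (9 / 10) A -> (0 < m)%N ->
  gstart T (fun h y => (all_flagged T h y)%:R) m <= (1 / 10) ^+ #|T|.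
Proof.
move=> obl m0; rewrite /gstart.
rewrite (sum_prod_condition T _ (fun=> sum_init_copy1)).
rewrite [leRHS](_ : _ = \sum_(r : copies) (\prod_j init_copy (r j)) * (1 / 10) ^+ #|T|); last first.
  by rewrite -mulr_suml sum_prod_init_copy [RHS]mul1r.
apply: ler_sum => r _; rewrite ler_wpM2l ?prod_init_copy_ge0 //.
apply: gvalue_all_flagged => //.
- exact: init_copy_ge0.
- exact: sum_init_copy1.
- move=> w wm; have -> : 1 / 10 = 1 - 9 / 10 :> R by lra.
  exact: oblivious_flag_prob obl _ _.
Qed.

Definition many_flagged (r : nat) (h : transcript R n) (y : copies) : bool :=
  (r <= #|[set j | (y j).1]|)%N.

(** Any [r] flagged copies contain ['C(r, t)] fully flagged sets of size [t]; dividing by this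
    number improves on a plain union bound over sets. *)
Lemma many_flagged_le r t h y :
  'C(r, t)%:R * (many_flagged r h y)%:R <=
  \sum_(T : {set 'I_k} | #|T| == t) (all_flagged T h y)%:R :> R.
Proof.
rewrite /many_flagged; case: leqP => [ry|_]; last by rewrite mulr0 sumr_ge0.
rewrite mulr1 -natr_sum ler_nat (leq_trans (leq_bin2l _ ry)) //.
rewrite -cards_draws -sum1_card big_mkcond /= [leqRHS]big_mkcond leq_sum // => T _.
rewrite inE; case: eqP => _; rewrite ?andbF // andbT; case: ifP => // /fintype.subsetP TF.
rewrite lt0b; apply/forallP => j; apply/implyP => /TF.
by rewrite inE.
Qed.

Hypothesis e0_ge0 : 0 <= e0.

Lemma gstart_many_flagged (r t m : nat) :
  oblivious_guarantee g m a (9 / 10) A -> (0 < m)%N ->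
  (100 * t <= k)%N -> (2 * k <= 5 * r)%N -> (r <= k)%N ->
  5 * (e0 * t%:R) ^+ 2 * Lam%:R <= t%:R / 20 ->
  gstart noT (fun h y => (many_flagged r h y)%:R) m <= expR (- (t%:R / 20)).
Proof.
move=> obl m0 tk rk rk' lam.
have C0 : 0 < 'C(r, t)%:R :> R by rewrite ltr0n bin_gt0; lia.
(* As [r >= 2 k / 5] and [i < t <= k / 100], each factor is at most [(99/100) / (39/100) < 13/5]. *)
have ratio : 'C(k, t)%:R <= (13 / 5) ^+ t * 'C(r, t)%:R :> R.
  apply: bin_ratio => [|i it]; first by lra.
  rewrite -[13 / 5]/(13%:R / 5%:R) mulrAC ler_pdivlMr // -!natrM ler_nat; lia.
rewrite -(ler_pM2l C0).
have -> : 'C(r, t)%:R * gstart noT (fun h y => (many_flagged r h y)%:R) m =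
   gstart noT (fun h y => 'C(r, t)%:R * (many_flagged r h y)%:R) m.
  rewrite /gstart mulr_sumr; apply: eq_bigr => y _.
  by rewrite mulrCA gvalue_scale.
apply: (@le_trans _ _ (\sum_(T : {set 'I_k} | #|T| == t)
    gstart noT (fun h y => (all_flagged T h y)%:R) m)).
  rewrite /gstart exchange_big; apply: ler_sum => y _ /=.
  rewrite -mulr_sumr ler_wpM2l ?prod_init_copy_ge0 //.
  rewrite -gvalue_sum; apply: (@gvalue_le _ _ _ _ _ _ _ _ _ _ z0) => h' y'.
  exact: many_flagged_le.
have one T : #|T| = t -> gstart noT (fun h y => (all_flagged T h y)%:R) m <= (20 / 57) ^+ t.
  (* [3 ^+ t] approximates the optimal parameter [10^(t/2)]: the terms become [(3/10)^t] and at most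
     [(20/57)^t]. *)
  move=> Tt; have b0 : 0 < 3 ^+ t :> R by rewrite exprn_gt0.
  apply: (@le_trans _ _ ((3 ^+ t * gstart T (fun h y => (all_flagged T h y)%:R) m +
     (3 ^+ t)^-1 * expR (cost e0 T * Lam%:R)) / 2)).
    rewrite /gstart [X in _ + X](_ : _ = \sum_(y : copies) (\prod_j init_copy (y j)) *
       ((3 ^+ t)^-1 * expR (cost e0 T * Lam%:R))); last first.
      by rewrite -mulr_suml sum_prod_init_copy mul1r.
    rewrite mulr_sumr -big_split /= mulr_suml; apply: ler_sum => y _.
    apply: le_trans (ler_wpM2l (prod_init_copy_ge0 y)
       (gvalue_chi2 g a val z0 adv e0_ge0 T (all_flagged T) m [::] y (z0, ord0) b0)) _.
    rewrite /= subr0 le_eqVlt; apply/orP; left; apply/eqP; ring.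
  have E : expR (cost e0 T * Lam%:R) <= (20 / 19) ^+ t.
    rewrite /cost Tt; apply: (@le_trans _ _ (expR (t%:R / 20))); first by rewrite ler_expR.
    rewrite expRM_natl; apply: lerXn2r; [by rewrite nnegrE expR_ge0|by rewrite nnegrE; lra|].
    apply: le_trans (expR_le_inv _) _; first lra.
    by rewrite -[leLHS]mul1r ler_pdivrMr; lra.
  have S := gstart_all_flagged T obl m0; rewrite Tt in S.
  have : 3 ^+ t * gstart T (fun h y => (all_flagged T h y)%:R) m <= (20 / 57) ^+ t.
    apply: le_trans (ler_wpM2l (ltW b0) S) _.
    by rewrite -exprMn; apply: lerXn2r; rewrite ?nnegrE; lra.
  have : (3 ^+ t)^-1 * expR (cost e0 T * Lam%:R) <= (20 / 57) ^+ t.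
    apply: le_trans (ler_wpM2l _ E) _; first by rewrite invr_ge0 ltW.
    by rewrite -exprVn -exprMn; apply: lerXn2r; rewrite ?nnegrE; lra.
  lra.
apply: (@le_trans _ _ ('C(k, t)%:R * (20 / 57) ^+ t)).
  apply: le_trans (ler_sum _ (fun T Tt => one T (eqP Tt))) _.
  rewrite sumr_const -[leLHS]mulr_natl ler_wpM2r //.
  have := card_draws 'I_k t; rewrite card_ord => <-.
  by rewrite ler_nat subset_leq_card //; apply/fintype.subsetP => T; rewrite inE.
(* Per unit of [t]: [(13/5) (20/57) = 52/57 <= 1 - 1/20 <= expR (- 1/20)]. *)
apply: le_trans (ler_wpM2r _ ratio) _; first by apply: exprn_ge0; lra.
rewrite mulrAC mulrC ler_wpM2l ?(ltW C0) // -exprMn.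
have -> : - (t%:R / 20) = t%:R * (- 20^-1) :> R by rewrite mulrN.
rewrite expRM_natl; apply: lerXn2r; [by rewrite nnegrE; lra|by rewrite nnegrE expR_ge0|].
by apply: le_trans (expR_ge1Dx _); lra.
Qed.

End ManyFlags.

(** * Correctness while few copies fail *)

Lemma accurateE (R : realType) (b y z : R) : 0 <= b ->
  accurate b y z = (`|z - y| <= b * `|y|).
Proof.
move=> b0; rewrite /accurate ler_distl.
have [y0|y0] := leP 0 y.
  rewrite ger0_norm // min_l ?max_r; [|nra|nra].
  by rewrite mulrBl mulrDl mul1r.
rewrite ltr0_norm // min_r ?max_l; [|nra|nra].
by rewrite mulrBl mulrDl mul1r mulrN opprK.
Qed.

(** * Flip sequences of a growing stream *)

Section Flips.

Variables (R : realType) (n : nat) (g : stream n -> R) (a : R).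
Implicit Types (st : stream n) (idx : seq nat).

(** The condition of [has_flips] for a stream still in progress, of any length. *)
Definition flips st idx : Prop :=
  [/\ all (fun i => i <= size st)%N idx, sorted ltn idx
    & sorted (fun i j => ~~ accurate a (g (take i st)) (g (take j st))) idx].

Lemma flips_cat st st' idx : flips st idx -> flips (st ++ st') idx.
Proof.
move=> [le_idx lt_idx fl_idx]; split=> //.
  by apply: sub_all le_idx => i ist; rewrite size_cat (leq_trans ist) // leq_addr.
move: fl_idx; rewrite (@eq_in_sorted _ (fun i => i <= size st)%N _
  (fun i j => ~~ accurate a (g (take i (st ++ st'))) (g (take j (st ++ st')))) _ _ le_idx) //.
by move=> i j; rewrite -!topredE /= => ist jst; rewrite !takel_cat.
Qed.

Lemma sorted_rcons_last (e : rel nat) idx i :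
  sorted e idx -> ((0 < size idx)%N -> e (last 0%N idx) i) -> sorted e (rcons idx i).
Proof.
case: idx => //= j idx jidx; rewrite rcons_path jidx /=; exact.
Qed.

Lemma flips_rcons st u idx : flips st idx ->
  ((0 < size idx)%N ->
    ~~ accurate a (g (take (last 0%N idx) st)) (g (rcons st u))) ->
  flips (rcons st u) (rcons idx (size st).+1).
Proof.
move=> fl mv; have [] := flips_cat [:: u] fl; rewrite cats1 => le_idx lt_idx fl_idx.
have lastP : (0 < size idx)%N -> (last 0 idx <= size st)%N.
  clear -fl; case: fl => /allP H _ _; case: idx H => //= i s H _.
  by apply: H; apply: mem_last.
split.
- by rewrite all_rcons le_idx size_rcons leqnn.
- by apply: sorted_rcons_last => // /lastP; rewrite ltnS.
- apply: sorted_rcons_last => // ne; have := mv ne.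
  rewrite (@take_oversize _ (size st).+1) ?size_rcons //.
  by rewrite -cats1 takel_cat ?lastP.
Qed.

Lemma flips_leq st idx m : (0 < size st)%N -> (size st <= m)%N -> flips st idx ->
  (size idx <= flip_number a m g)%N.
Proof.
case: st => // u st _ stm fl.
(* Padding to length [m] with the first update leaves the listed flips intact. *)
have [] := flips_cat (nseq (m - size (u :: st)) u) fl.
set w := _ ++ _ => le_idx lt_idx fl_idx.
have wm : size w == m by rewrite size_cat size_nseq subnKC.
have idxm : (size idx < m.+2)%N.
  rewrite ltnS -(size_iota 0 m.+1); apply: uniq_leq_size.
    exact: sorted_uniq ltn_trans ltnn _ lt_idx.
  move=> i /(allP le_idx); rewrite (eqP wm) mem_iota add0n ltnS.
  by [].
have := @leq_bigmax_cond _ (fun l : 'I_m.+2 => `[< has_flips a m g l >])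
  (fun l => nat_of_ord l) (Ordinal idxm).
apply; apply/asboolP; exists (Tuple wm), idx; split=> //=.
by move: le_idx; rewrite (eqP wm).
Qed.

(** Indices are counted, not changes, so the single index 0 already gives 1. *)
Lemma flip_number_gt0 m (u : update n) : (0 < m)%N -> (0 < flip_number a m g)%N.
Proof. by move=> m0; apply: (@flips_leq [:: u] [:: 0%N]). Qed.

End Flips.

(** * Tracking of [g] by the current candidate *)

Section Correctness.

Variables (R : realType) (n : nat) (A : algorithm R n) (g : stream n -> R).
Variables (a e0 : R) (k : nat) (X : finType) (val : X -> R) (z0 : X) (m r : nat).
Local Notation Lam := (flip_number a m g).
Variable adv : adversary R n.
Local Notation mstate := (X * 'I_Lam.+1)%type.
Local Notation copy := (bool * state A)%type.
Local Notation copies := {ffun 'I_k -> copy}.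
Local Notation noT := (finset.set0 : {set 'I_k}).
Local Notation mech := (mech_prob a e0 val).
Local Notation gvalue := (gvalue (A := A) g a e0 val adv).
Local Notation votes := (votes val).
Implicit Types (st : stream n) (x : 'I_k -> state A) (q : mstate).

Hypotheses (a_gt0 : 0 < a) (a_lt : a < 1 / 10) (e0_ge0 : 0 <= e0).
(** [r] is [2 k / 5] rounded up, so fewer than [r] flagged copies are fewer than [2 k / 5]. *)
Hypotheses (r_lt : (5 * r < 2 * k + 5)%N) (r_le : (2 * k <= 5 * r)%N).
Hypothesis grid : forall st, (size st <= m)%N ->
  exists z, `|val z - g st| <= a * `|g st|.

(* [idx] lists the replacement times; the current candidate was accurate at the
   last of them. *)
Definition tracked st q : Prop :=
  exists2 idx, size idx = q.2 /\ flips g a st idx &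
    (0 < size idx)%N ->
      `|val q.1 - g (take (last 0%N idx) st)| <= 43 / 10 * a * `|g (take (last 0%N idx) st)|.

Lemma last_flips st idx : flips g a st idx -> (last 0 idx <= size st)%N.
Proof.
case: idx => //= i s [/allP + _ _]; apply; exact: mem_last.
Qed.

Lemma tracked_rcons st u q : tracked st q -> tracked (rcons st u) q.
Proof.
move=> [idx [sz fl] cl]; exists idx; first by split; rewrite // -cats1; apply: flips_cat.
by rewrite -cats1 takel_cat // last_flips.
Qed.

(** Union bound over one wrong decision to keep or replace and [#|X|] wrong choices; [k / 10] is the
    distance of [2 k / 5] and [3 k / 5] votes from the threshold [k / 2]. *)
Definition misfire_prob : R := (#|X|.+1)%:R * expR (- (e0 * k%:R / 10)).

Section Votes.

Variables (st : stream n) (x : 'I_k -> state A) (F : {set 'I_k}).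
Hypotheses (F_lt : (#|F| < r)%N).
Hypothesis F_acc : forall j, j \notin F -> accurate a (g st) (estimate (x j)).

Lemma good_dist j : j \notin F -> `|estimate (x j) - g st| <= a * `|g st|.
Proof. by move=> /F_acc; rewrite accurateE // ltW. Qed.

(** Converts tolerances relative to an estimate into tolerances relative to [g], and back. *)
Lemma good_norm j : j \notin F ->
  9 / 10 * (a * `|g st|) <= a * `|estimate (x j)| <= 11 / 10 * (a * `|g st|).
Proof.
move=> /good_dist; set y := estimate _; set Y := g st => H.
have h1 := ler_distD y Y 0; have h2 := ler_distD Y y 0.
rewrite !subr0 in h1 h2; rewrite distrC in h1.
have aY : a * `|Y| <= 1 / 10 * `|Y| by rewrite ler_wpM2r // ltW.
by apply/andP; split; rewrite mulrCA ler_pM2l //; lra.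
Qed.

Lemma votes_ge (tau : R) z :
  (forall j, j \notin F ->
     `|val z - estimate (x j)| <= tau * `|estimate (x j)|) ->
  3 * k%:R / 5 <= (votes tau noT x z)%:R :> R.
Proof.
move=> H; have : (k - #|F| <= votes tau noT x z)%N.
  rewrite leq_subLR -[leqLHS]card_ord -(cardsC F) leq_add2l.
  apply: subset_leq_card; apply/fintype.subsetP => j.
  by rewrite !inE /= => /H.
move=> Hv; rewrite ler_pdivrMr // -!natrM ler_nat; lia.
Qed.

Lemma votes_le (tau : R) z :
  (forall j, j \notin F ->
     ~~ (`|val z - estimate (x j)| <= tau * `|estimate (x j)|)) ->
  (votes tau noT x z)%:R <= 2 * k%:R / 5 :> R.
Proof.
move=> H; have : (votes tau noT x z <= #|F|)%N.
  apply: subset_leq_card; apply/fintype.subsetP => j.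
  by rewrite !inE /=; apply: contraLR => /H.
move=> Hv; rewrite ler_pdivlMr // -!natrM ler_nat; lia.
Qed.

Lemma fire_le z : 3 * k%:R / 5 <= (votes (8 * a) noT x z)%:R :> R ->
  (1 + keep_odds a e0 val noT x z)^-1 <= expR (- (e0 * k%:R / 10)).
Proof.
move=> v; apply: (@le_trans _ _ (keep_odds a e0 val noT x z)^-1).
  rewrite lef_pV2 ?posrE ?keep_odds1_gt0 ?keep_odds_gt0 //; lra.
rewrite /keep_odds -expRN ler_expR.
have : 0 <= e0 * ((votes (8 * a) noT x z)%:R - 3 * k%:R / 5) by rewrite mulr_ge0 ?subr_ge0.
lra.
Qed.

Lemma keep_le z : (votes (8 * a) noT x z)%:R <= 2 * k%:R / 5 :> R ->
  keep_odds a e0 val noT x z / (1 + keep_odds a e0 val noT x z) <= expR (- (e0 * k%:R / 10)).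
Proof.
move=> v; apply: (@le_trans _ _ (keep_odds a e0 val noT x z)).
  rewrite ler_pdivrMr ?keep_odds1_gt0 //.
  by have := keep_odds_gt0 a e0 val noT x z; nra.
rewrite /keep_odds ler_expR.
have : 0 <= e0 * (2 * k%:R / 5 - (votes (8 * a) noT x z)%:R) by rewrite mulr_ge0 ?subr_ge0.
lra.
Qed.

(** The grid has a point next to [g] with at least [3 k / 5] votes, whose weight alone dominates
    that of [z]. *)
Lemma choice_le z : (size st <= m)%N -> (votes (3 * a) noT x z)%:R <= 2 * k%:R / 5 :> R ->
  choice_prob a e0 val noT x z <= expR (- (e0 * k%:R / 10)).
Proof.
move=> /grid[z1 z1P] v.
have v1 : 3 * k%:R / 5 <= (votes (3 * a) noT x z1)%:R :> R.
  (* The distance is at most [2 a |g|], and [2 / (9/10) < 3]. *)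
  apply: votes_ge => j jF; have /andP[n1 n2] := good_norm jF; have d := good_dist jF.
  have := ler_distD (g st) (val z1) (estimate (x j)); rewrite (distrC (g st)).
  lra.
rewrite /choice_prob ler_pdivrMr; last exact: sum_score_gt0.
apply: (@le_trans _ _ (expR (- (e0 * k%:R / 10)) * score a e0 val noT x z1)).
  rewrite /score -expRD ler_expR.
  have : 0 <= e0 * (2 * k%:R / 5 - (votes (3 * a) noT x z)%:R) by rewrite mulr_ge0 ?subr_ge0.
  have : 0 <= e0 * ((votes (3 * a) noT x z1)%:R - 3 * k%:R / 5) by rewrite mulr_ge0 ?subr_ge0.
  have : 0 <= e0 * k%:R by rewrite mulr_ge0.
  lra.
rewrite ler_wpM2l ?expR_ge0 // (bigD1 z1) //= lerDl sumr_ge0 // => z' _.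
by rewrite ltW // score_gt0.
Qed.

End Votes.

(** If [g] has not flipped since the last replacement, the candidate is still good and only an
    unlikely replacement can do harm. Otherwise a replacement is legitimate, and what can go wrong
    is keeping a bad candidate or drawing one. *)
Lemma misfire st u x q (F : {set 'I_k}) : (size st < m)%N -> tracked st q ->
  (#|F| < r)%N ->
  (forall j, j \notin F -> accurate a (g (rcons st u)) (estimate (x j))) ->
  \sum_o mech noT x q o *
    (~~ `[< accurate (10 * a) (g (rcons st u)) (val (next q o).1) /\
            tracked (rcons st u) (next q o) >])%:R <= misfire_prob.
Proof.
set st' := rcons st u => stm tr Fr Facc.
have stm' : (size st' <= m)%N by rewrite size_rcons.
have a10 : 0 <= 10 * a by rewrite mulr_ge0 // ltW.
have tr' : tracked st' q by apply: tracked_rcons.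
have [idx [sz fl] cl] := tr.
have E0 := expR_ge0 (- (e0 * k%:R / 10)).
have Y0 := normr_ge0 (g st').
have K0 T := mech_ge0 a e0 val z0 T x q.
have -> : misfire_prob = expR (- (e0 * k%:R / 10)) + #|X|%:R * expR (- (e0 * k%:R / 10)).
  by rewrite /misfire_prob -[#|X|.+1%:R]natr1; ring.
have [stable|moved] := boolP ((0 < size idx)%N &&
    accurate a (g (take (last 0%N idx) st)) (g st')).
  case/andP: stable => ne; rewrite accurateE ?(ltW a_gt0) // => stab.
  have {cl} := cl ne; set gl := g (take _ _) in stab * => cl.
  have gl0 := normr_ge0 gl.
  have glY : (1 - a) * `|gl| <= `|g st'|.
    have := ler_distD (g st') gl 0; rewrite !subr0 (distrC gl); lra.
  have zY := ler_distD gl (val q.1) (g st'); rewrite (distrC gl) in zY.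
  have agl : a * `|gl| <= 1 / 10 * `|gl| by rewrite ler_wpM2r // ltW.
  have agl' : 9 / 10 * (a * `|gl|) <= a * `|g st'| by rewrite mulrCA ler_pM2l //; lra.
  have aY0 : 0 <= a * `|g st'| by rewrite mulr_ge0 // ltW.
  (* [(43/10 + 1) / (9/10) < 6]; below, [(6 + 1) / (9/10) < 8], so all good copies vote for the
     candidate. *)
  have zY' : `|val q.1 - g st'| <= 6 * a * `|g st'| by lra.
  apply: ler_wpDr; first by rewrite mulr_ge0.
  have okN : `[< accurate (10 * a) (g st') (val (next q None).1) /\ tracked st' (next q None) >].
    by apply/asboolP; split=> //; rewrite accurateE //=; lra.
  rewrite sum_option okN mulr0 add0r /mech_prob; case: (q.2 < Lam)%N; last first.
    by rewrite big1 // => z _; rewrite mul0r.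
  apply: (@le_trans _ _ (\sum_z (1 + keep_odds a e0 val noT x q.1)^-1 *
     choice_prob a e0 val noT x z)).
    apply: ler_sum => z _; rewrite ler_piMr ?lern1 ?leq_b1 //.
    by rewrite mulr_ge0 ?invr_ge0 // ltW // ?keep_odds1_gt0 ?choice_prob_gt0.
  rewrite -mulr_sumr sum_choice_prob // mulr1; apply: fire_le.
  apply: (votes_ge Fr) => j jF.
  have /andP[n1 n2] := good_norm Facc jF; have d := good_dist Facc jF.
  have := ler_distD (g st') (val q.1) (estimate (x j)); rewrite (distrC (g st')).
  lra.
have fl' : flips g a st' (rcons idx (size st).+1).
  by apply: flips_rcons => // ne; move: moved; rewrite ne.
(* Adding the present time to [idx] gives a longer flip sequence, so the budget cannot be
   exhausted. *)
have qL : (q.2 < Lam)%N.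
  have := flips_leq _ stm' fl'; rewrite size_rcons sz; apply.
  by rewrite size_rcons.
rewrite sum_option; apply: lerD; last first.
  rewrite [leRHS](_ : _ = \sum_(z : X) expR (- (e0 * k%:R / 10))); last first.
    by rewrite sumr_const mulr_natl.
  apply: ler_sum => z _.
  have [okz|nokz] := boolP (`[< _ >]); first by rewrite mulr0.
  rewrite mulr1 /mech_prob qL.
  apply: le_trans (_ : choice_prob a e0 val noT x z <= _).
    rewrite ler_piMl ?(ltW (choice_prob_gt0 _ _ _ _ _ _ _)) // invf_le1 ?keep_odds1_gt0 //.
    by rewrite lerDl ltW ?keep_odds_gt0.
  apply: (choice_le Fr Facc stm'); apply: (votes_le Fr) => j jF.
  apply: contra nokz => zj; apply/asboolP.
  have /andP[n1 n2] := good_norm Facc jF; have d := good_dist Facc jF.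
  have zY := ler_distD (estimate (x j)) (val z) (g st').
  (* [3 (11/10) + 1 = 43/10]. *)
  have zY' : `|val z - g st'| <= 43 / 10 * a * `|g st'| by lra.
  split; first by rewrite accurateE //=; lra.
  exists (rcons idx (size st).+1).
    by split=> //; rewrite size_rcons sz /= inordK.
  by rewrite last_rcons take_oversize ?size_rcons.
have [okN|nokN] := boolP (`[< _ >]); first by rewrite mulr0.
rewrite mulr1 /mech_prob qL; apply: keep_le; apply: (votes_le Fr) => j jF.
apply: contra nokN => zj; apply/asboolP; split=> //.
have /andP[n1 n2] := good_norm Facc jF; have d := good_dist Facc jF.
have zY := ler_distD (estimate (x j)) (val q.1) (g st').
(* [8 (11/10) + 1 < 10]. *)
by rewrite accurateE //=; lra.
Qed.

Lemma prod_kern_flag st u (y y' : copies) j :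
  \prod_j kern g a st u (y j) (y' j) != 0 ->
  (y' j).1 = new_flag g a (rcons st u) (y j).1 (y' j).2.
Proof.
rewrite (bigD1 j) //= mulf_eq0 negb_or => /andP[+ _].
by rewrite /kern; case: ((y' j).1 =P _) => //= _; rewrite mulr0 eqxx.
Qed.

(** Flags are never cleared, so this event is absorbing. *)
Lemma gvalue_many_flagged m' h (y : copies) q : many_flagged r h y ->
  gvalue noT (fun h y => (many_flagged r h y)%:R) m' h y q = 1.
Proof.
elim: m' h y q => [|m' IH] h y q my /=; first by rewrite my.
rewrite -[RHS](sum_prod_kern g a (unzip1 h) (adv h) y); apply: eq_bigr => y' _.
have [->|ne] := eqVneq (\prod_j kern g a (unzip1 h) (adv h) (y j) (y' j)) 0.
  by rewrite mul0r.
rewrite [X in _ * X](_ : _ = 1) ?mulr1 //.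
rewrite -[RHS](sum_mech a e0 val z0 noT (fun j => (y' j).2) q).
apply: eq_bigr => o _; rewrite IH ?mulr1 //.
apply: leq_trans my _; apply: subset_leq_card; apply/fintype.subsetP => j.
by rewrite !inE (prod_kern_flag j ne) /new_flag => ->.
Qed.

(** Union bound over the remaining rounds: each breaks the invariant with probability at most
    [misfire_prob], unless many copies get flagged, which the first term pays for. *)
Lemma gvalue_inaccurate m' h (y : copies) q : (size h + m' <= m)%N ->
  (all_accurate g (10 * a) h /\ tracked (unzip1 h) q) \/ many_flagged r h y ->
  gvalue noT (fun h _ => (~~ all_accurate g (10 * a) h)%:R) m' h y q <=
  gvalue noT (fun h y => (many_flagged r h y)%:R) m' h y q + m'%:R * misfire_prob.
Proof.
have mis0 : 0 <= misfire_prob by rewrite mulr_ge0 ?expR_ge0.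
have le1 m'' h' y' q' :
    gvalue noT (fun h _ => (~~ all_accurate g (10 * a) h)%:R) m'' h' y' q' <= 1.
  apply: (@le_trans _ _ (gvalue noT (fun _ _ => 1) m'' h' y' q')).
    by apply: (@gvalue_le _ _ _ _ _ _ _ _ _ _ z0) => h1 y1; rewrite lern1 leq_b1.
  by rewrite gvalue_cst.
elim: m' h y q => [|m' IH] h y q hm inv.
  by rewrite /= mul0r addr0 ler_nat; case: inv => [[-> _]|->]; rewrite ?leq_b1.
case: (boolP (many_flagged r h y)) => [my|nmy].
  by rewrite gvalue_many_flagged // (le_trans (le1 _ _ _ _)) // lerDl mulr_ge0.
have {inv nmy} [acc tr] : all_accurate g (10 * a) h /\ tracked (unzip1 h) q.
  by case: inv => // my; rewrite my in nmy.
rewrite /=; set st := unzip1 h; set u := adv h.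
rewrite [m'.+1%:R * _](_ : _ = \sum_(y' : copies)
   (\prod_j kern g a st u (y j) (y' j)) * (m'.+1%:R * misfire_prob)); last first.
  by rewrite -mulr_suml sum_prod_kern mul1r.
rewrite -big_split /=; apply: ler_sum => y' _; rewrite -mulrDr.
have [->|ne] := eqVneq (\prod_j kern g a st u (y j) (y' j)) 0; first by rewrite !mul0r.
rewrite ler_wpM2l ?prod_kern_ge0 //.
set x := fun j => (y' j).2.
pose h' o := rcons h (u, val (next q o).1).
have hm' o : (size (h' o) + m' <= m)%N by rewrite size_rcons addSnnS.
rewrite [m'.+1%:R * _](_ : _ = m'%:R * misfire_prob + misfire_prob); last first.
  by rewrite -[m'.+1%:R]natr1 mulrDl mul1r.
rewrite addrA.
rewrite [m'%:R * _](_ : _ = \sum_o mech noT x q o * (m'%:R * misfire_prob)); last first.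
  by rewrite -mulr_suml sum_mech // mul1r.
rewrite -big_split /=.
have [my'|nmy'] := boolP (many_flagged r h y').
  apply: ler_wpDr => //; apply: ler_sum => o _; rewrite -mulrDr.
  apply: ler_wpM2l; first exact: (mech_ge0 _ _ _ z0).
  by apply: IH; [apply: hm'|right].
have := @misfire st u x q [set j | (y' j).1].
rewrite size_map -addn1 (leq_trans _ hm) ?leq_add2l // ltnNge => /(_ isT tr nmy').
move=> mis; apply: le_trans (_ : _ <= _) (lerD (lexx _) (mis _)); last first.
  move=> j; rewrite inE (prod_kern_flag j ne) /new_flag negb_or negbK.
  by case/andP.
rewrite -big_split /=; apply: ler_sum => o _; rewrite -!mulrDr ler_wpM2l ?mech_ge0 //.
case: asboolP => [[acc' tr']|_] /=.
  rewrite addr0; apply: IH; [exact: hm'|left].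
  by rewrite all_accurate_rcons acc /unzip1 map_rcons.
rewrite mulr1n; apply: le_trans (le1 _ _ _ _) _; rewrite lerDr addr_ge0 ?mulr_ge0 //.
apply: (@le_trans _ _ (gvalue noT (fun _ _ => 0) m' (h' o) y' (next q o))).
  by rewrite gvalue_cst.
by apply: (@gvalue_le _ _ _ _ _ _ _ _ _ _ z0) => h1 y1.
Qed.

End Correctness.

(** * The robustness guarantee and its parameters *)

Section RobustGuarantee.

Variables (R : realType) (n : nat) (A : algorithm R n) (g : stream n -> R).
Variables (a e0 delta : R) (k m t : nat) (X : finType) (val : X -> R) (z0 : X).

Lemma robust_alg_guarantee : 0 < a -> a < 1 / 10 -> 0 <= e0 -> (0 < m)%N ->
  (forall st, (size st <= m)%N -> exists z, `|val z - g st| <= a * `|g st|) ->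
  oblivious_guarantee g m a (9 / 10) A ->
  (100 * t <= k)%N ->
  5 * (e0 * t%:R) ^+ 2 * (flip_number a m g)%:R <= t%:R / 20 ->
  expR (- (t%:R / 20)) <= delta / 2 ->
  m%:R * misfire_prob e0 k X <= delta / 2 ->
  robust_guarantee g m (10 * a) (1 - delta)
    (robust_alg A a e0 k (flip_number a m g) val z0).
Proof.
move=> a0 a1 e00 m0 grid obl tk cost_le td md adv.
set Lam := flip_number a m g.
pose r := ((2 * k + 4) %/ 5)%N.
have [r1 r2 r3] : [/\ (5 * r < 2 * k + 5)%N, (2 * k <= 5 * r)%N & (r <= k)%N].
  by rewrite /r; split; lia.
have many := @gstart_many_flagged R n A g a e0 k Lam X val z0 adv e00 r t m
  obl m0 tk r2 r3 cost_le.
rewrite (game_prob_gstart A g).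
pose noT := finset.set0 : {set 'I_k}.
(* Success and failure are indexed by [b], so that [gvalue_sum] over booleans shows they have total
   mass 1. *)
pose acc b (h : transcript R n) (_ : {ffun 'I_k -> bool * state A}) : R :=
  ((all_accurate g (10 * a) h) == b)%:R.
have total : gstart g a e0 Lam val z0 adv noT (acc true) m +
             gstart g a e0 Lam val z0 adv noT (acc false) m = 1 :> R.
  apply: etrans (sum_prod_init_copy A k); rewrite /gstart -big_split /=.
  apply: eq_bigr => y _; rewrite -mulrDr -[RHS]mulr1; congr (_ * _).
  have := gvalue_sum g a e0 val adv noT predT acc m [::] y (z0, ord0 : 'I_Lam.+1).
  rewrite big_bool => <-.
  rewrite -[RHS](@gvalue_cst _ _ A g a e0 k Lam X val z0 adv noT 1 m [::] y (z0, ord0)).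
  congr (gvalue _ _ _ _ _ _ _ _ _ _ _); apply/funext => h; apply/funext => y'.
  by rewrite big_bool /acc; case: all_accurate; rewrite /= ?addr0 ?add0r.
have fail : gstart g a e0 Lam val z0 adv noT (acc false) m <=
    gstart g a e0 Lam val z0 adv noT (fun h y => (many_flagged (A := A) r h y)%:R) m +
    m%:R * misfire_prob e0 k X :> R.
  have -> : m%:R * misfire_prob e0 k X = \sum_(y : {ffun 'I_k -> bool * state A})
     (\prod_j init_copy (y j)) * (m%:R * misfire_prob e0 k X).
    by rewrite -mulr_suml sum_prod_init_copy mul1r.
  rewrite /gstart -big_split /=; apply: ler_sum => y _.
  rewrite -mulrDr ler_wpM2l ?prod_init_copy_ge0 //.
  have -> : acc false = fun h _ => (~~ all_accurate g (10 * a) h)%:R.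
    by apply/funext => h; apply/funext => y'; rewrite /acc; case: all_accurate.
  apply: (gvalue_inaccurate z0 adv a0 a1 e00 r1 r2 grid) => //; left; split.
    by apply/all_accurateP.
  by exists [::].
have -> : (fun h (_ : {ffun 'I_k -> bool * state A}) => (all_accurate g (10 * a) h)%:R) = acc true.
  by apply/funext => h; apply/funext => y'; rewrite /acc; case: all_accurate.
lra.
Qed.

End RobustGuarantee.

(** * Degenerate cases: a single memory state *)

Lemma le_accurate (R : realType) (b b' y z : R) : 0 <= b -> b <= b' ->
  accurate b y z -> accurate b' y z.
Proof.
move=> b0 bb'; rewrite !accurateE ?(le_trans b0) // => /le_trans; apply.
by rewrite ler_wpM2r.
Qed.

Lemma le_all_accurate (R : realType) (n : nat) (g : stream n -> R) (b b' : R) h :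
  0 <= b -> b <= b' -> all_accurate g b h -> all_accurate g b' h.
Proof.
move=> b0 bb' /all_accurateP H; apply/all_accurateP => i ih.
exact: (le_accurate b0 bb' (H i ih)).
Qed.

Section SingleState.

Variables (R : realType) (n : nat) (A : algorithm R n) (s0 : state A).
Hypothesis single : forall s : state A, s = s0.

Lemma game_prob_single adv E m :
  game_prob A adv m E =
  (E (iter m (fun h => rcons h (adv h, estimate s0)) [::]))%:R.
Proof.
have from h (s : state A) : game_prob_from adv E m h s =
    (E (iter m (fun h => rcons h (adv h, estimate s0)) h))%:R.
  elim: m h s => [|m IH] h s //.
  rewrite iterSr /=; set c := (X in _ = X).
  rewrite (eq_bigr (fun s' => step s (adv h) s' * c)).
    by rewrite -mulr_suml Defs.pmf_sum1 mul1r.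
  by move=> s' _; rewrite IH (single s').
rewrite /game_prob; under eq_bigr => s _ do rewrite from.
by rewrite -mulr_suml Defs.pmf_sum1 mul1r.
Qed.

(** With one state the outputs are constant, so the adversary plays a predetermined stream; success
    then has probability 0 or 1, and [0 < p] forces 1. *)
Lemma single_robust (g : stream n -> R) (m : nat) (b b' p q : R) :
  0 <= b -> b <= b' -> 0 < p -> q <= 1 ->
  oblivious_guarantee g m b p A -> robust_guarantee g m b' q A.
Proof.
move=> b0 bb' p0 q1 obl adv; rewrite game_prob_single.
pose play := fun i => iter i (fun h => rcons h (adv h, estimate s0)) [::].
have size_play i : size (play i) = i.
  by elim: i => //= i IH; rewrite size_rcons -[in RHS]IH.
have := obl (fun i => adv (play i)); rewrite game_prob_single.
have -> : iter m (fun h => rcons h (adv (play (size h)), estimate s0)) [::] = play m.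
  by elim: m {obl} => //= i ->; rewrite size_play.
rewrite -/(play m); case: (boolP (all_accurate g b _)) => [acc _|_].
  by rewrite (le_all_accurate b0 bb' acc).
by move=> /(lt_le_trans p0); rewrite ltxx.
Qed.

End SingleState.

Section ConstantAlgorithm.

Variables (R : realType) (n : nat) (z : R).

Lemma const_pmf_sum1 : \sum_(x : unit) (1 : R) = 1.
Proof. by rewrite sumr_const card_unit. Qed.

Definition const_dist : fdist R unit := FDist (fun=> ler01) const_pmf_sum1.

Definition const_alg : algorithm R n :=
  @Algorithm R n unit const_dist (fun _ _ => const_dist) (fun=> z).

Lemma const_alg_robust (g : stream n -> R) (m : nat) (b p : R) :
  (forall y, accurate b y z) -> p <= 1 -> robust_guarantee g m b p const_alg.
Proof.
move=> acc p1 adv; rewrite (@game_prob_single _ _ const_alg tt) => [|[]//].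
suff -> : all_accurate g b (iter m (fun h => rcons h (adv h, z)) [::]) by [].
elim: m => [|m IH] /=; first exact/all_accurateP.
by rewrite all_accurate_rcons IH acc.
Qed.

Lemma const_alg_bits : space_bits const_alg = 0%N.
Proof. by rewrite /space_bits card_unit up_log1. Qed.

End ConstantAlgorithm.

(** * Candidate grid and logarithmic bounds *)

Section Grid.

Variables (R : realType) (step : R) (M : nat).

(** An arithmetic grid centred at 0 is fine enough, since nonzero values of [g] are polynomially
    bounded away from 0 and only the logarithm of its size matters. *)
Definition grid_val (i : 'I_(M + M).+1) : R := (i%:R - M%:R) * step.

Lemma grid_near (y : R) : 0 < step -> `|y| <= M%:R * step ->
  exists i, `|grid_val i - y| <= step.
Proof.
move=> s0 yM; set w := y / step + M%:R.
have yE : y = (w - M%:R) * step by rewrite /w addrK divfK ?gt_eqF.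
have [w0 wM] : 0 <= w /\ w <= (M + M)%:R.
  move: yM; rewrite ler_norml => /andP[y1 y2].
  have h1 : - M%:R <= y / step by rewrite ler_pdivlMr // mulNr.
  have h2 : y / step <= M%:R by rewrite ler_pdivrMr.
  by rewrite natrD /w; split; lra.
have := truncn_itv w0 => /andP[iw wi].
have iM : (Num.truncn w < (M + M).+1)%N.
  by rewrite ltnS -(ler_nat R) (le_trans iw).
exists (Ordinal iM); rewrite /grid_val /= [y in X in X <= _]yE -mulrBl.
rewrite normrM (gtr0_norm s0) ler_piMl ?(ltW s0) // ler_norml.
move: wi; rewrite -[_.+1%:R]natr1 => wi; apply/andP; split; lra.
Qed.

Lemma grid_zero : exists i, grid_val i = 0.
Proof.
have iM : (M < (M + M).+1)%N by rewrite ltnS leq_addr.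
by exists (Ordinal iM); rewrite /grid_val subrr mul0r.
Qed.

End Grid.

Lemma poly_range_bounds (R : realType) n (c y : R) : (0 < n)%N ->
  poly_range n c y -> y = 0 \/ (n%:R `^ c)^-1 <= `|y| <= n%:R `^ c.
Proof.
move=> n0; have N0 : 0 < (n%:R : R) `^ c by rewrite powR_gt0 // ltr0n.
have N0' : 0 < ((n%:R : R) `^ c)^-1 by rewrite invr_gt0.
case/or3P => [/andP[y1 y2]|/eqP->|/andP[y1 y2]]; [right|by left|right].
  by rewrite ler0_norm; [apply/andP; split; lra|lra].
by rewrite ger0_norm; [rewrite y1|lra].
Qed.

Lemma up_logM_le (x y : nat) : (up_log 2 (x * y) <= up_log 2 x + up_log 2 y)%N.
Proof. by apply: up_log_min => //; rewrite expnD leq_mul ?up_logP. Qed.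

Lemma up_logX_le (x k : nat) : (up_log 2 (x ^ k) <= k * up_log 2 x)%N.
Proof. by apply: up_log_min => //; rewrite mulnC expnM; case: k => // k; rewrite leq_exp2r ?up_logP. Qed.

(** Rounding up costs 1; the factor 2 changes base, by [expR (1/2) <= 2]. *)
Lemma up_log_expR (R : realType) (x : nat) (b : R) : 0 <= b -> x%:R <= expR b ->
  (up_log 2 x)%:R <= 1 + 2 * b.
Proof.
move=> b0 xb; have [x1|x1] := leqP x 1.
  have -> : up_log 2 x = 0%N by apply/eqP; rewrite up_log_eq0 x1.
  lra.
have := up_log_gtn (isT : 1 < 2)%N x1; have := up_log_gt0 2 x; rewrite x1 /=.
case: (up_log 2 x) => // l _ /= lx.
have h2 : expR (2^-1) <= 2 :> R.
  by apply: le_trans (expR_le_inv _) _; [lra|rewrite -[leLHS]mul1r ler_pdivrMr; lra].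
have : expR (l%:R * 2^-1) <= expR b.
  apply: le_trans xb; rewrite expRM_natl; apply: (@le_trans _ _ (2 ^+ l)).
    by apply: lerXn2r; rewrite ?nnegrE ?expR_ge0.
  by rewrite -natrX ler_nat ltnW.
rewrite ler_expR -[l.+1%:R]natr1; lra.
Qed.

Section Olog.

Variable R : realType.
Implicit Types x y : R.

Lemma Olog_ge1 x : 1 <= Olog x. Proof. by rewrite le_max lexx. Qed.

Lemma ln_le_Olog x : ln x <= Olog x. Proof. by rewrite le_max lexx orbT. Qed.

Lemma le_Olog x y : 0 < x -> x <= y -> Olog x <= Olog y.
Proof.
move=> x0 xy; rewrite ge_max Olog_ge1 /= (le_trans _ (ln_le_Olog y)) //.
by rewrite ler_ln ?posrE // (lt_le_trans x0).
Qed.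

Lemma expR_Olog x : 0 < x -> x <= expR (Olog x).
Proof. by move=> x0; rewrite -[leLHS]lnK ?posrE // ler_expR ln_le_Olog. Qed.

End Olog.

Lemma powR_ln_le (R : realType) (n : nat) (c b : R) : (0 < n)%N -> 0 < c ->
  ln (n%:R : R) <= b -> (n%:R : R) `^ c <= expR (c * b).
Proof.
move=> n0 c0 nb; rewrite -[leLHS]lnK ?posrE ?powR_gt0 ?ltr0n //.
by rewrite ler_expR ln_powR ler_pM2l.
Qed.

Lemma le_48_expR (R : realType) : 48 <= expR 6 :> R.
Proof.
have -> : (6 : R) = 6%:R * 1 by rewrite mulr1.
have h : 2 <= expR (1 : R) by have := expR_ge1Dx (1 : R); lra.
have : 2 ^+ 6 <= expR 1 ^+ 6 :> R by apply: lerXn2r; rewrite ?nnegrE ?expR_ge0.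
rewrite -expRM_natl; apply: le_trans; lra.
Qed.

Lemma truncnS_itv (R : realType) (x : R) : 0 <= x ->
  x <= (Num.truncn x).+1%:R <= x + 1.
Proof.
move=> /truncn_itv/andP[h1 h2]; rewrite ltW //=.
by rewrite -[_.+1%:R]natr1 lerD2r.
Qed.

(** * Choice of parameters and space count *)

Theorem theorem3p4 (R : realType) (c kappa : R) (hc : 0 < c)
    (hkappa : 0 < kappa) :
  exists2 C : R, 0 < C &
    forall (n m : nat) (g : stream n -> R) (alpha delta : R)
           (L : R -> R -> R) (A : algorithm R n),
      (0 < n)%N -> (0 < m)%N ->
      ln (m%:R : R) <= kappa * ln (n%:R : R) ->
      ln (n%:R : R) <= kappa * ln (m%:R : R) ->
      (forall s : stream n, (size s <= m)%N -> poly_range n c (g s)) ->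
      (forall s : state A, poly_range n c (estimate s)) ->
      0 < alpha -> 0 < delta < 1 ->
      oblivious_guarantee g m (alpha / 10) (9 / 10) A ->
      (space_bits A)%:R <= L (alpha / 10) (1 / 10) ->
      exists2 B : algorithm R n,
        robust_guarantee g m alpha (1 - delta) B &
        (space_bits B)%:R <=
          C * (L (alpha / 10) (1 / 10)
               * Num.sqrt ((flip_number (alpha / 10) m g)%:R * Olog (1 / delta))
               * Olog (m%:R / (alpha * delta))).
Proof.
(* [expR (K * D)] must absorb 48 (6 of the 7), [m / (alpha delta)] (the other 1) and [N^2]
   ([2 c kappa]). In [704 K + 3], the copies take [700 K + 1], grid and counter [4 K + 2]. *)
pose K := 7 + 2 * (c * kappa).
have K7 : 7 <= K by rewrite lerDl mulr_ge0 // mulr_ge0 // ltW.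
have K0 : 0 <= 700 * K by lra.
have C0 : 0 < 704 * K + 3 by lra.
exists (704 * K + 3) => //.
move=> n m g alpha delta L A n0 m0 _ nm grange _ alpha0 /andP[delta0 delta1] obl.
set a := alpha / 10; set Lam := flip_number a m g; set ell := Olog (1 / delta).
set D := Olog _; set S := Num.sqrt _ => bitsL.
have alphaE : alpha = 10 * a by rewrite mulrC divfK.
have a0 : 0 < a by rewrite divr_gt0.
have D1 : 1 <= D := Olog_ge1 _.
have D0 : 0 <= D := le_trans ler01 D1.
have S0 : 0 <= S := sqrtr_ge0 _.
have L0 : 0 <= L a (1 / 10) := le_trans (ler0n _ _) bitsL.
have bound0 : 0 <= (704 * K + 3) * (L a (1 / 10) * S * D).
  by rewrite !mulr_ge0 ?(ltW C0) // (le_trans ler01).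
have q1 : 1 - delta <= 1 by lra.
(* For [alpha >= 1] the estimate 0 is always accurate. *)
have [alpha1|alpha1] := leP 1 alpha.
  exists (const_alg n (0 : R)); last by rewrite const_alg_bits.
  apply: const_alg_robust => // y.
  by rewrite accurateE ?(ltW alpha0) // sub0r normrN ler_peMl.
(* Here [L] may vanish, so [B] may not use a single bit; in the other case [L >= 1] absorbs additive
   terms. *)
have [bits0|bits0] := posnP (space_bits A).
  exists A; last by rewrite bits0.
  have /card_le1_eqP single : (#|state A| <= 1)%N.
    by move/eqP: bits0; rewrite up_log_eq0.
  case: (pickP (fun _ : state A => true)) => [s0 _|nos]; last first.
    have := Defs.pmf_sum1 (init A); rewrite big_pred0 => [/eqP|s]; last exact: nos.
    by rewrite eq_sym oner_eq0.
  apply: (@single_robust _ _ A s0 _ g m a alpha (9 / 10)) => //.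
  - by move=> s; apply: single.
  - exact: ltW.
  - rewrite alphaE; lra.
have bits1 : 1 <= L a (1 / 10) by apply: le_trans bitsL; rewrite ler1n.
have Lam0 : (0 < Lam)%N := flip_number_gt0 g a (Ordinal n0, 0) m0.
have LamM : (Lam <= m.+1)%N by apply/bigmax_leqP => l _; rewrite -ltnS.
have ell1 : 1 <= ell := Olog_ge1 _.
have S2 : S ^+ 2 = Lam%:R * ell by rewrite sqr_sqrtr // mulr_ge0 //; lra.
have Lam1 : 1 <= Lam%:R :> R by rewrite ler1n.
have S1 : 1 <= S by rewrite -(@ler_pXn2r _ 2) ?nnegrE // expr1n S2; nra.
have M1 : 1 <= m%:R :> R by rewrite ler1n.
have ad0 : 0 < alpha * delta by rewrite mulr_gt0.
have ad1 : alpha * delta <= 1 by nra.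
have mD : m%:R <= m%:R / (alpha * delta) by rewrite ler_pdivlMr // ler_piMr //; lra.
have ellD : ell <= D.
  apply: le_Olog; first by rewrite divr_gt0.
  rewrite ler_pM ?invr_ge0 ?(ltW delta0) // lef_pV2 ?posrE //; nra.
have lnmD : ln (m%:R : R) <= D.
  by apply: le_trans (ln_le_Olog _); rewrite ler_ln ?posrE //; lra.
pose N := (n%:R : R) `^ c.
have N0 : 0 < N by apply: powR_gt0; rewrite ltr0n.
have big : 48 * (m%:R / (alpha * delta)) * N ^+ 2 <= expR (K * D).
  have -> : K * D = 6 * D + D + (c * (kappa * D)) + (c * (kappa * D)) by rewrite /K; ring.
  rewrite !expRD expr2 -[leRHS]mulrA.
  have ND : N <= expR (c * (kappa * D)).
    by apply: powR_ln_le => //; apply: (le_trans nm); rewrite ler_pM2l.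
  have mdD := expR_Olog (divr_gt0 (lt_le_trans ltr01 M1) ad0).
  have e6 : 48 <= expR (6 * D) by apply: le_trans (le_48_expR R) _; rewrite ler_expR; lra.
  have md0 : 0 <= m%:R / (alpha * delta) by rewrite divr_ge0 // ltW.
  by rewrite (ler_pM _ _ (ler_pM _ _ e6 mdD) (ler_pM _ _ ND ND)) ?mulr_ge0 ?invr_ge0 ?(ltW N0) ?(ltW ad0).
(* With spacing [a / N], a relative error [a] at the least value [1 / N], this many points reach
   [N]. *)
pose M := (Num.truncn (N ^+ 2 / a)).+1.
have MN : N ^+ 2 / a <= M%:R <= N ^+ 2 / a + 1.
  by apply: truncnS_itv; rewrite divr_ge0 ?sqr_ge0 ?ltW.
(* [t / 20 >= 2 ell >= ell + 1] gives failure probability at most [delta / 2]. *)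
pose t := (Num.truncn (40 * ell)).+1.
have tell : 40 * ell <= t%:R <= 40 * ell + 1 by apply: truncnS_itv; lra.
(* Makes [e0 k / 10 = k / (700 S)] at least [K D]. *)
pose k := (Num.truncn (700 * K * (S * D))).+1.
have SD : 1 <= S * D by rewrite mulr_ege1.
have kK : 700 * K * (S * D) <= k%:R <= 700 * K * (S * D) + 1.
  exact: truncnS_itv (mulr_ge0 K0 (le_trans ler01 SD)).
(* The total cost becomes [(t / 20) (t / (49 ell))], and [t <= 41 ell]. *)
pose e0 := (70 * S)^-1.
have S0' : 0 < S := lt_le_trans ltr01 S1.
have e00 : 0 <= e0 by rewrite invr_ge0 mulr_ge0.
have N1 : 1 <= N.
  rewrite -[leLHS](powRr0 (n%:R : R)); apply: ler_powR; last exact: ltW.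
  by rewrite ler1n.
(* [2 M + 2 <= 20 Q + 4 <= 24 Q] for [Q = N^2 / alpha >= 1]. *)
have cardX : (#|'I_(M + M).+1|.+1)%:R <= 24 * N ^+ 2 / alpha.
  have Q1 : 1 <= N ^+ 2 / alpha by rewrite ler_pdivlMr // mul1r (le_trans (ltW alpha1)) // exprn_ege1.
  have QE : N ^+ 2 / a = 10 * (N ^+ 2 / alpha) by rewrite /a; field; rewrite gt_eqF.
  have -> : (#|'I_(M + M).+1|.+1)%:R = M%:R + M%:R + 2 :> R.
    by rewrite card_ord -addn2 addnAC !natrD -addn1 natrD; ring.
  rewrite -mulrA; case/andP: MN => _; rewrite QE; move: Q1; clear; lra.
have cardXK : m%:R * (#|'I_(M + M).+1|.+1)%:R * (2 / delta) <= expR (K * D).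
  apply: le_trans big; apply: (@le_trans _ _ (m%:R * (24 * N ^+ 2 / alpha) * (2 / delta))).
    by rewrite ler_wpM2r ?divr_ge0 ?(ltW delta0) // ler_wpM2l.
  rewrite le_eqVlt; apply/orP; left; apply/eqP; field.
  by rewrite !gt_eqF.
have X2 : 2 <= (#|'I_(M + M).+1|.+1)%:R :> R by rewrite card_ord ler_nat.
have d2 : 2 <= 2 / delta by rewrite ler_pdivlMr // ler_piMr // ltW.
have mX : m%:R * 2 <= m%:R * (#|'I_(M + M).+1|.+1)%:R :> R by rewrite ler_wpM2l.
have XK2 : m%:R * (#|'I_(M + M).+1|.+1)%:R * 2 <= expR (K * D).
  by apply: le_trans cardXK; rewrite ler_wpM2l // mulr_ge0.
have [t1 t2] := andP tell; have [k1 k2] := andP kK.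
pose B := robust_alg A a e0 k Lam (@grid_val R (a / N) M) ord0.
exists B.
  rewrite alphaE; apply: (@robust_alg_guarantee R n A g a e0 delta k m t) => //.
  - by rewrite ltr_pM2r ?invr_gt0.
  - move=> st /grange/(poly_range_bounds n0)-[->|/andP[y1 y2]].
      by have [i E] := grid_zero (a / N) M; exists i; rewrite E subrr normr0 mulr0.
    have aN0 : 0 < a / N by rewrite divr_gt0.
    have yM : `|g st| <= M%:R * (a / N).
      apply: (le_trans y2); rewrite [leLHS](_ : _ = N ^+ 2 / a * (a / N)); last first.
        by rewrite mulrA divfK ?gt_eqF // expr2 mulfK ?gt_eqF.
      by rewrite ler_wpM2r ?(ltW aN0) //; case/andP: MN.
    have [i iP] := grid_near aN0 yM; exists i; apply: le_trans iP _.
    by rewrite ler_pM2l.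
  - rewrite -(ler_nat R) natrM; apply: le_trans k1.
    have DS : D <= S * D by rewrite ler_peMl.
    have := ler_pM (ler0n R 7) D0 K7 DS; move: t2 ellD ell1; clear; lra.
  - have -> : 5 * (e0 * t%:R) ^+ 2 * Lam%:R = t%:R / 20 * (t%:R / (49 * ell)).
      rewrite /e0 exprMn exprVn exprMn S2; field.
      by rewrite !gt_eqF // (lt_le_trans ltr01).
    rewrite ler_piMr ?divr_ge0 ?ler0n // ler_pdivrMr; by move: t2 ell1; clear; lra.
  - apply: (@le_trans _ _ (expR (- ell) * expR (- 1))).
      by rewrite -expRD ler_expR; move: t1 ell1; clear; lra.
    apply: ler_pM; rewrite ?expR_ge0 //.
      rewrite expRN -[leRHS]invrK lef_pV2 ?posrE ?expR_gt0 ?invr_gt0 //.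
      by rewrite -[leLHS]mul1r expR_Olog // divr_gt0.
    rewrite expRN lef_pV2 ?posrE ?expR_gt0 //.
    by have := expR_ge1Dx (1 : R); clear; lra.
  - have eK : K * D <= e0 * k%:R / 10.
      have -> : e0 * k%:R / 10 = k%:R / (700 * S) by rewrite /e0; field; rewrite gt_eqF.
      have p7 : 0 < 700 * S := mulr_gt0 (ltr0Sn R 699) S0'.
      by rewrite (ler_pdivlMr _ _ p7); move: k1; clear; lra.
    apply: (@le_trans _ _ (m%:R * (#|'I_(M + M).+1|.+1)%:R * expR (- (K * D)))).
      by rewrite mulrA ler_wpM2l ?mulr_ge0 // ler_expR lerN2.
    rewrite expRN ler_pdivrMr ?expR_gt0 // -ler_pdivrMl ?divr_gt0 // invf_div mulrC.
    exact: cardXK.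
have KD0 : 0 <= K * D by rewrite mulr_ge0 // (le_trans _ K7) ?ler0n.
have lX : (up_log 2 #|'I_(M + M).+1|)%:R <= 1 + 2 * (K * D).
  apply: up_log_expR => //; apply: le_trans XK2.
  have : (#|'I_(M + M).+1|)%:R <= (#|'I_(M + M).+1|.+1)%:R :> R by rewrite ler_nat.
  by move: mX M1 X2; clear; nra.
have lL : (up_log 2 Lam.+1)%:R <= 1 + 2 * (K * D).
  apply: up_log_expR => //; apply: le_trans XK2.
  have : Lam.+1%:R <= m%:R + 2 :> R by rewrite -natrD ler_nat addn2.
  by move: mX M1; clear; lra.
have bitsB : (space_bits B <= k * space_bits A +
    (up_log 2 #|'I_(M + M).+1| + up_log 2 Lam.+1))%N.
  rewrite /space_bits robust_state_card (leq_trans (up_logM_le _ _)) //.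
  by rewrite leq_add ?up_logX_le ?up_logM_le.
move: bitsB; rewrite -(ler_nat R) natrD natrM [(up_log _ _ + _)%:R]natrD => /le_trans; apply.
have kL : k%:R * (space_bits A)%:R <= (700 * K + 1) * (S * D) * L a (1 / 10).
  apply: ler_pM bitsL => //; apply: (le_trans k2).
  by move: SD; clear; lra.
have DL : (2 + 4 * K) * D <= (2 + 4 * K) * (L a (1 / 10) * S * D).
  apply: ler_wpM2l; first by move: K7; clear; lra.
  by rewrite ler_peMl // mulr_ege1.
by move: DL kL lX lL D1; clear; lra.
Qed.
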